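(* Let $I,J,M,N\subseteq\{1,\dots,n\}$ with $|I|=|J|$ and $|M|=|N|$. Then in $A=\mathcal{O}_q(M_n(k))$, $$q^{|I\cap M|}[I|J][M|N]=q^{|J\cap N|}[M|N][I|J]+q^{|J\cap N|}\sum_{\substack{S\in\{\le I\Vert M\}\\ T\in\{\ge J\Vert N\}\\ (S,T)\ne(I,J)}}\widetilde{\lambda}_S\,\mu_T\,[S^\natural|T^\natural][S|T],$$ where $S^\natural=S^\natural_{I,M}$, $T^\natural=T^\natural_{J,N}$, and $$\widetilde{\lambda}_S=(-\widehat{q})^{|I\setminus S|}(-q)^{-\mathcal{L}(S,I,M)}\xi_q(I\setminus S;S\setminus I),\qquad \mu_T=\widehat{q}^{\,|T\setminus J|}(-q)^{\mathcal{L}^\natural(T,J,N)}\xi_q(T\setminus J;J\setminus T)$$ for $S\in\{\le I\Vert M\}$ and $T\in\{\ge J\Vert N\}$.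
   Context: Let $k$ be a field, $n$ a positive integer, $q\in k^\times$, and $\widehat{q}=q-q^{-1}$. The algebra $A=\mathcal{O}_q(M_n(k))$ is the $k$-algebra with generators $X_{ij}$ ($1\le i,j\le n$) and relations: $X_{ij}X_{lj}=qX_{lj}X_{ij}$ for $i<l$; $X_{ij}X_{im}=qX_{im}X_{ij}$ for $j<m$; $X_{ij}X_{lm}=X_{lm}X_{ij}$ for $i<l$, $j>m$; $X_{ij}X_{lm}-X_{lm}X_{ij}=\widehat{q}\,X_{im}X_{lj}$ for $i<l$, $j<m$. Quantum minors: for $I=\{i_1<\cdots<i_t\}$ and $J=\{j_1<\cdots<j_t\}$, $[I|J]=\sum_{\sigma\in S_t}(-q)^{\ell(\sigma)}X_{i_1,j_{\sigma(1)}}\cdots X_{i_t,j_{\sigma(t)}}$, where $\ell(\sigma)$ is the length (number of inversions) of $\sigma$; $[\varnothing|\varnothing]=1$. For such $I,J$, $I\le J$ means $i_l\le j_l$ for all $l$. For $S,T\subseteq\{1,\dots,n\}$, $\ell(S;T)=|\{(s,t)\in S\times T\mid s>t\}|$. For $d\in\mathbb{N}$, $[d]_{-q}=(-q)^{d-1}+(-q)^{d-3}+\cdots+(-q)^{-(d-1)}$. For index sets $U\ge V$ of the same cardinality $m$, write $U=\{r_1<\cdots<r_m\}$, set $d_l=|[1,r_l]\cap V|-l+1$ (which is $\ge1$) and define $\xi_q(U;V)=[d_1]_{-q}\cdots[d_m]_{-q}$, with $\xi_q(\varnothing;\varnothing)=1$. For $X,Y\subseteq\{1,\dots,n\}$: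 $\{\le X\Vert Y\}=\{S\subseteq X\cup Y\mid X\cap Y\subseteq S,\ |S|=|X|,\ S\le X\}$ and $\{\ge X\Vert Y\}=\{T\subseteq X\cup Y\mid X\cap Y\subseteq T,\ |T|=|X|,\ T\ge X\}$. For $X\cap Y\subseteq S\subseteq X\cup Y$, $S^\natural=S^\natural_{X,Y}=(X\cap Y)\sqcup\bigl((X\cup Y)\setminus S\bigr)$. For $S\in\{\le X\Vert Y\}$ and $T\in\{\ge X\Vert Y\}$ (with $\natural$ taken relative to $X,Y$), $\mathcal{L}(S,X,Y)=\ell\bigl((S\setminus S^\natural)\cup(Y\setminus X);X\setminus S\bigr)-\ell\bigl((S\setminus S^\natural)\cup(Y\setminus X);S\setminus X\bigr)$, $\mathcal{L}^\natural(T,X,Y)=\ell\bigl((T^\natural\setminus T)\cup(X\setminus Y);T\setminus X\bigr)-\ell\bigl((T^\natural\setminus T)\cup(X\setminus Y);X\setminus T\bigr)$. *)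

(* Defs.v *)
From HB Require Import structures.
From mathcomp Require Import all_boot all_order all_algebra perm.
From mathcomp Require Import generic_quotient ring_quotient boolp.
From mathcomp Require Import monalg finmap.

Set Implicit Arguments.
Unset Strict Implicit.
Unset Printing Implicit Defensive.

Import GRing.Theory.
Local Open Scope ring_scope.

Section AlgebraQuotient.
Variables (k : fieldType) (F : lalgType k) (G : F -> Prop).

(* The two-sided ideal of F generated by G. *)
Inductive ideal_gen : F -> Prop :=
| ideal_gen_gen x : G x -> ideal_gen x
| ideal_gen0 : ideal_gen 0
| ideal_genB x y : ideal_gen x -> ideal_gen y -> ideal_gen (x - y)
| ideal_genMl a x : ideal_gen x -> ideal_gen (a * x)
| ideal_genMr a x : ideal_gen x -> ideal_gen (x * a).

Lemma ideal_genN x : ideal_gen x -> ideal_gen (- x).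
Proof. by move=> hx; rewrite -sub0r; apply: ideal_genB => //; exact: ideal_gen0. Qed.

Definition ideal_gen_pred : {pred F} := fun x => `[< ideal_gen x >].

Lemma ideal_gen_predP x : reflect (ideal_gen x) (x \in ideal_gen_pred).
Proof. exact: asboolP. Qed.

Fact ideal_gen_zmod_closed : zmod_closed ideal_gen_pred.
Proof.
split=> [|x y /ideal_gen_predP hx /ideal_gen_predP hy]; apply/ideal_gen_predP.
  exact: ideal_gen0.
exact: ideal_genB.
Qed.

HB.instance Definition _ :=
  GRing.isZmodClosed.Build F ideal_gen_pred ideal_gen_zmod_closed.

(* ring_quotient only provides the ring structure for commutative rings. *)
Definition algquot : Type := Quotient.quot ideal_gen_pred.
HB.instance Definition _ := GRing.Zmodule.on algquot.

Definition algpi (a : F) : algquot := (\pi_(Quotient.quot ideal_gen_pred) a)%qT.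
Definition algrepr (a : algquot) : F := generic_quotient.repr a.

Lemma algpiP a b : algpi a = algpi b <-> ideal_gen (a - b).
Proof.
rewrite /algpi; split => [/eqP|h].
  by rewrite -Quotient.idealrBE => /ideal_gen_predP.
by apply/eqP; rewrite -Quotient.idealrBE; apply/ideal_gen_predP.
Qed.

Lemma algreprK : cancel algrepr algpi.
Proof. by move=> a; exact: reprK. Qed.

Lemma algpiB a b : algpi (a - b) = algpi a - algpi b.
Proof. exact: (raddfB (\pi_(Quotient.quot ideal_gen_pred))%qT). Qed.

Lemma algpiD a b : algpi (a + b) = algpi a + algpi b.
Proof. exact: (raddfD (\pi_(Quotient.quot ideal_gen_pred))%qT). Qed.

Definition algquot_one : algquot := algpi 1.
Definition algquot_mul (a b : algquot) : algquot := algpi (algrepr a * algrepr b).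
Definition algquot_scale (c : k) (a : algquot) : algquot := algpi (c *: algrepr a).

Lemma algquot_mulE a b : algquot_mul (algpi a) (algpi b) = algpi (a * b).
Proof.
rewrite /algquot_mul.
have ha : ideal_gen (algrepr (algpi a) - a) by apply/algpiP; exact: algreprK.
have hb : ideal_gen (algrepr (algpi b) - b) by apply/algpiP; exact: algreprK.
move: (algrepr (algpi a)) (algrepr (algpi b)) ha hb => a' b' ha hb; apply/algpiP.
have -> : a' * b' - a * b = (a' - a) * b' - a * - (b' - b).
  by rewrite mulrN opprK mulrBl mulrBr addrA subrK.
apply: ideal_genB; first exact: ideal_genMr.
by apply: ideal_genMl; exact: ideal_genN.
Qed.

Lemma algquot_scaleE c a : algquot_scale c (algpi a) = algpi (c *: a).
Proof.
apply/algpiP; rewrite -scalerBr -[_ - a]mul1r scalerAl.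
by apply: ideal_genMl; apply/algpiP; exact: algreprK.
Qed.

Fact algquot_mulA : associative algquot_mul.
Proof.
move=> a b c; rewrite -[a]algreprK -[b]algreprK -[c]algreprK.
by rewrite !algquot_mulE mulrA.
Qed.

Fact algquot_mul1r : left_id algquot_one algquot_mul.
Proof. by move=> a; rewrite -[a]algreprK algquot_mulE mul1r. Qed.

Fact algquot_mulr1 : right_id algquot_one algquot_mul.
Proof. by move=> a; rewrite -[a]algreprK algquot_mulE mulr1. Qed.

Fact algquot_mulDl : left_distributive algquot_mul +%R.
Proof.
move=> a b c; rewrite -[a]algreprK -[b]algreprK -[c]algreprK.
by rewrite -algpiD !algquot_mulE -algpiD mulrDl.
Qed.

Fact algquot_mulDr : right_distributive algquot_mul +%R.
Proof.
move=> a b c; rewrite -[a]algreprK -[b]algreprK -[c]algreprK.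
by rewrite -algpiD !algquot_mulE -algpiD mulrDr.
Qed.

Fact algquot_scalerA a b v :
  algquot_scale a (algquot_scale b v) = algquot_scale (a * b) v.
Proof. by rewrite -[v]algreprK !algquot_scaleE scalerA. Qed.

Fact algquot_scale1r : left_id 1 algquot_scale.
Proof. by move=> v; rewrite -[v]algreprK !algquot_scaleE scale1r. Qed.

Fact algquot_scalerDr : right_distributive algquot_scale +%R.
Proof.
move=> c u v; rewrite -[u]algreprK -[v]algreprK.
by rewrite -algpiD !algquot_scaleE -algpiD scalerDr.
Qed.

Fact algquot_scalerDl v : {morph algquot_scale^~ v : a b / a + b}.
Proof.
by move=> a b /=; rewrite -[v]algreprK !algquot_scaleE -algpiD scalerDl.
Qed.

Fact algquot_scalerAl (c : k) (u v : algquot) :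
  algquot_scale c (algquot_mul u v) = algquot_mul (algquot_scale c u) v.
Proof.
by rewrite -[u]algreprK -[v]algreprK !(algquot_mulE, algquot_scaleE) scalerAl.
Qed.

Fact algquot_scalerAr : (forall (c : k) (u v : F), c *: (u * v) = u * (c *: v)) ->
  forall (c : k) (u v : algquot),
  algquot_scale c (algquot_mul u v) = algquot_mul u (algquot_scale c v).
Proof.
move=> hF c u v.
by rewrite -[u]algreprK -[v]algreprK !(algquot_mulE, algquot_scaleE) hF.
Qed.

Fact algquot_one_neq0 : ~ ideal_gen 1 -> algquot_one != 0.
Proof.
move=> h1; apply/eqP => h; apply: h1; rewrite -[1]subr0; apply/algpiP.
by rewrite -[LHS]/algquot_one h -[0 in RHS](subrr 0) algpiB subrr.
Qed.

End AlgebraQuotient.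

Fact malg_scalerAr (K : monomType) (R : comNzRingType) (c : R)
  (u v : {malg R[K]}) : c *: (u * v) = u * (c *: v).
Proof.
apply/malgP=> m; rewrite mcoeffZ mcoeffMl mulr_sumr.
rewrite (mcoeffMlw m (fsubset_refl _) (msuppZ_le c v)).
apply: eq_bigr => m1 _; rewrite mulr_sumr; apply: eq_bigr => m2 _.
by rewrite mcoeffZ mulrnAr mulrCA.
Qed.

Section Relations.
Variables (k : fieldType) (q : k) (n : nat) (F : lalgType k).
Variable x : 'I_n -> 'I_n -> F.

Definition qhat : k := q - q^-1.

(* Differences of the two sides of the defining relations. *)
Inductive Oq_relator : F -> Prop :=
| Oq_relator_col (i l j : 'I_n) : (i < l)%N ->
    Oq_relator (x i j * x l j - q *: (x l j * x i j))
| Oq_relator_row (i j m : 'I_n) : (j < m)%N ->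
    Oq_relator (x i j * x i m - q *: (x i m * x i j))
| Oq_relator_comm (i j l m : 'I_n) : (i < l)%N -> (j > m)%N ->
    Oq_relator (x i j * x l m - x l m * x i j)
| Oq_relator_cross (i j l m : 'I_n) : (i < l)%N -> (j < m)%N ->
    Oq_relator (x i j * x l m - x l m * x i j - qhat *: (x i m * x l j)).

Lemma Oq_relator_proper (ev : {rmorphism F -> k}) :
    (forall c a, ev (c *: a) = c * ev a) -> (forall i j, ev (x i j) = 0) ->
  ~ ideal_gen Oq_relator 1.
Proof.
move=> evZ ev0 h1.
suff ideal0 a : ideal_gen Oq_relator a -> ev a = 0.
  by move/eqP: (ideal0 _ h1); rewrite rmorph1 oner_eq0.
elim=> {h1 a} [_ []||y z _ hy _ hz|b y _ hy|b y _ hy] *;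
  rewrite ?rmorph0 ?rmorphB ?evZ ?rmorphM /=;
  by rewrite ?ev0 ?hy ?hz ?(mul0r, mulr0, subr0).
Qed.

End Relations.

Section QuantumMatrices.
Variables (k : fieldType) (q : k) (n : nat).

(* The free k-algebra on the letters (i, j), as the algebra of words. *)
Definition freeX : Type := {malg k[{fmonom ('I_n * 'I_n)%type}]}.
HB.instance Definition _ := GRing.Lalgebra.on freeX.

Definition freeX_gen (i j : 'I_n) : freeX := mkmalgU (fmu (i, j)) 1.

Fact freeX_scalerAr (c : k) (u v : freeX) : c *: (u * v) = u * (c *: v).
Proof. exact: malg_scalerAr. Qed.

Fact Oq_ideal_proper : ~ ideal_gen (Oq_relator q freeX_gen) 1.
Proof.
pose ev : {rmorphism freeX -> k} := mcoeff mone.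
apply: (@Oq_relator_proper _ _ _ _ _ ev) => [c a|i j]; first exact: mcoeffZ.
by rewrite /ev /= mcoeffU -[_ == _]/(fmu (i, j) == mone) fm1_eq1.
Qed.

Definition Oq : Type := algquot (Oq_relator q freeX_gen).
HB.instance Definition _ := GRing.Zmodule.on Oq.
HB.instance Definition _ := GRing.Zmodule_isNzRing.Build Oq
  (@algquot_mulA _ _ _) (@algquot_mul1r _ _ _) (@algquot_mulr1 _ _ _)
  (@algquot_mulDl _ _ _) (@algquot_mulDr _ _ _)
  (algquot_one_neq0 Oq_ideal_proper).
HB.instance Definition _ := GRing.Zmodule_isLmodule.Build k Oq
  (@algquot_scalerA _ _ _) (@algquot_scale1r _ _ _)
  (@algquot_scalerDr _ _ _) (@algquot_scalerDl _ _ _).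
HB.instance Definition _ :=
  GRing.Lmodule_isLalgebra.Build k Oq (@algquot_scalerAl _ _ _).
HB.instance Definition _ :=
  GRing.Lalgebra_isAlgebra.Build k Oq (algquot_scalerAr freeX_scalerAr).

Definition Oq_gen (i j : 'I_n) : Oq := algpi (Oq_relator q freeX_gen) (freeX_gen i j).

End QuantumMatrices.

(* For a set of ordinals, enum (hence enum_val) is increasing. *)
Section IndexSets.
Variable n : nat.
Implicit Types I J S T X Y : {set 'I_n}.

Definition setle I J : bool :=
  all2 (fun i j : 'I_n => (i <= j)%N) (enum I) (enum J).

(* l(S;T) *)
Definition ell S T : nat := #|[set p in setX S T | (p.1 > p.2)%N]|.

(* {<= X || Y} and {>= X || Y} *)
Definition lower_sets X Y : {set {set 'I_n}} :=
  [set S : {set 'I_n} | [&& S \subset X :|: Y, X :&: Y \subset S,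
                            #|S| == #|X| & setle S X]].

Definition upper_sets X Y : {set {set 'I_n}} :=
  [set T : {set 'I_n} | [&& T \subset X :|: Y, X :&: Y \subset T,
                            #|T| == #|X| & setle X T]].

(* S^natural relative to X, Y *)
Definition natset X Y S : {set 'I_n} := (X :&: Y) :|: ((X :|: Y) :\: S).

Definition calL S X Y : int :=
  let D := (S :\: natset X Y S) :|: (Y :\: X) in
  (ell D (X :\: S))%:Z - (ell D (S :\: X))%:Z.

Definition calLnat T X Y : int :=
  let D := (natset X Y T :\: T) :|: (X :\: Y) in
  (ell D (T :\: X))%:Z - (ell D (X :\: T))%:Z.

End IndexSets.

Section QuantumMinors.
Variables (k : fieldType) (q : k) (n : nat).
Implicit Types I J M N S T U V : {set 'I_n}.

Definition perm_length t (s : 'S_t) : nat :=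
  #|[set p : 'I_t * 'I_t | (p.1 < p.2)%N && (s p.1 > s p.2)%N]|.

(* [I|J], meaningful when #|I| = #|J|; the default value enum_val l of nth is *)
(* then never used.                                                          *)
Definition qminor I J : Oq q n :=
  \sum_(s : 'S_#|I|) (- q) ^+ perm_length s *:
    \prod_(l < #|I|) Oq_gen q (enum_val l) (nth (enum_val l) (enum J) (s l)).

(* [d]_{-q} = (-q)^(d-1) + (-q)^(d-3) + ... + (-q)^(-(d-1)) *)
Definition qint (d : nat) : k :=
  \sum_(i < d) (- q) ^ (d%:Z - 1 - (2 * i)%N%:Z).

(* xi_q(U;V), for U >= V. Here l counts from 0, so that the argument of qint *)
(* is d_(l+1) = |[1, r_(l+1)] :&: V| - l; it is positive when U >= V.        *)
Definition xi U V : k :=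
  \prod_(l < #|U|) qint (#|[set v in V | (v <= enum_val l)%N]| - l)%N.

Definition lamt I M S : k :=
  (- qhat q) ^+ #|I :\: S| * (- q) ^ (- calL S I M) * xi (I :\: S) (S :\: I).

Definition mu J N T : k :=
  qhat q ^+ #|T :\: J| * (- q) ^ calLnat T J N * xi (T :\: J) (J :\: T).

End QuantumMinors.

(* Main.v *)
Require Import Defs.
From HB Require Import structures.
From mathcomp Require Import all_boot all_order all_algebra perm.
From mathcomp Require Import zify ring.

Set Implicit Arguments.
Unset Strict Implicit.
Unset Printing Implicit Defensive.

Import GRing.Theory.
Local Open Scope ring_scope.

(* Let a_i and b_i generate two copies of the quantum exterior algebra with    *)
(* the Hecke cross relations of [braided]. In this algebra b_P a_T and a_T b_P *)
(* can be reordered into the other shape with explicit coefficients            *)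
(* ([kernel]); crossing the smallest letter of T first makes the recursion for *)
(* these coefficients collapse to telescoping sums, which is where the quantum *)
(* integers of xi come from. Passing to the converse algebra replaces q by     *)
(* q^-1, so that one computation gives both lambda and mu.                     *)
(*   The elements a'_i = sum_j X_ij a_j and b'_i = sum_j X_ij b_j satisfy the  *)
(* same relations, and a'_I = sum_J [I|J] a_J. Reordering a'_I b'_M into the   *)
(* b'_S' a'_S, expanding these in the b_P a_T, and reordering back into the    *)
(* a_J b_N expresses [I|J][M|N] by the products [S'|P][S|T]. Comparing the     *)
(* coefficients of a_J b_N is legitimate because the monomials a_J b_N are     *)
(* independent over O_q(M_n) in a model built from nested 4 x 4 matrices.      *)

(** * Counting in sets of ordinals *)

(** The identity compares coefficients in an algebra where quantum minors occur as coordinates. Let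
    a_i and b_i generate two quantum exterior algebras linked by the cross relations of [braided].
    The relations of O_q(M_n) ensure that a'_i = sum_j X_ij a_j and b'_i = sum_j X_ij b_j satisfy
    the same relations ([coact_braided]), and a'_I expands as the sum of the [I|J] a_J
    ([aprod_coact]).

    The cross relations preserve the indices with multiplicity and the number of a's. Hence
    reordering b_P a_T yields only monomials a_J b_N in which J determines N; this is the origin of
    the sets [natset]. The coefficients are given by [kernel] ([reorder]). They are checked by a
    recursion on the smallest letter t of T: either t lies in P ([kernel_step_mem]), or t leaves J
    and a sum of powers of -q forms a quantum integer ([kernel_step_drop]), or t stays in J and the
    sum telescopes to 1 ([kernel_step_stay]). The converse algebra satisfies the same relations with
    q^-1, so [reorder_conv] treats a_T b_P; this accounts for the sign of qhat and the negated
    exponent in lambda.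

    Now reorder a'_I b'_M into the b'_S' a'_S, expand these in minors, and reorder each b_P a_T.
    Equating the coefficients of a_J b_N gives [minor_commutation]; it is justified by the
    independence of these monomials in [model_exists]. Finally [xi] vanishes unless the order
    condition of [lower_sets] or [upper_sets] holds ([xi_setle]), and the term (S,T) = (I,J) is the
    leading product [M|N][I|J] ([kernel_sumE]). *)

Section OrdinalSets.
Variable n : nat.
Implicit Types (t j x : 'I_n) (S T U V P J : {set 'I_n}).

Definition below J j : nat := #|[set x in J | (x < j)%N]|.
Definition above J j : nat := #|[set x in J | (j < x)%N]|.
Definition between J j t : nat := #|[set x in J | (j < x < t)%N]|.

Lemma sorted_enum J : sorted ltn (map val (enum J)).
Proof.
rewrite {1}/enum_mem -enumT -[map _ _]/(map val (filter (mem J) (enum 'I_n))).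
apply: (subseq_sorted ltn_trans (map_subseq _ (filter_subseq _ _))).
by rewrite val_enum_ord iota_ltn_sorted.
Qed.

Lemma enum_setU1_min t T :
  (forall x, x \in T -> (t < x)%N) -> enum (t |: T) = t :: enum T.
Proof.
move=> tT; apply: (inj_map val_inj).
apply: (irr_sorted_eq ltn_trans ltnn (sorted_enum _)).
  rewrite /= path_min_sorted ?sorted_enum //.
  by apply/allP=> _ /mapP[x xT ->]; apply: tT; rewrite -mem_enum.
move=> v; rewrite /= inE; apply/mapP/orP => [[x]|].
  rewrite mem_enum !inE => /orP[/eqP->|xT] ->; first by left.
  by right; apply/mapP; exists x; rewrite ?mem_enum.
case=> [/eqP->|/mapP[x xT ->]].
  by exists t; rewrite ?mem_enum ?setU11.
by exists x; rewrite // mem_enum setU1r // -mem_enum.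
Qed.

(** Adjoining a new minimum only adds a factor on the left of an increasing product, so this is the
    induction that suits [aprod]. *)
Lemma set_min_ind (Q : {set 'I_n} -> Prop) :
  Q set0 -> (forall t T, (forall x, x \in T -> (t < x)%N) -> Q T -> Q (t |: T)) ->
  forall T, Q T.
Proof.
move=> Q0 QU T; elim: {T}#|T| {-2}T (leqnn #|T|) => [|m IHm] T.
  by rewrite leqn0 cards_eq0 => /eqP->.
have [->//|[t0 t0T]] := set_0Vmem T.
case: (@arg_minnP _ t0 (mem T) val t0T) => t tT tmin cT.
rewrite -(setD1K tT); apply: QU => [x|].
  rewrite !inE => /andP[xt xT]; rewrite ltn_neqAle tmin // andbT.
  by rewrite eq_sym (inj_eq val_inj).
by apply: IHm; move: cT; rewrite (cardsD1 t) [t \in T]tT.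
Qed.

Lemma card_sub_sum (J : {set 'I_n}) (p : pred 'I_n) :
  #|[set x in J | p x]| = (\sum_(x in J) p x)%N.
Proof.
rewrite -sum1_card big_mkcond [RHS]big_mkcond /=.
by apply: eq_bigr => x _; rewrite inE; case: (x \in J); case: (p x).
Qed.

Lemma belowU1 x J j : x \notin J -> below (x |: J) j = ((x < j) + below J j)%N.
Proof. by move=> xJ; rewrite /below !card_sub_sum big_setU1. Qed.

Lemma aboveU1 x J j : x \notin J -> above (x |: J) j = ((j < x) + above J j)%N.
Proof. by move=> xJ; rewrite /above !card_sub_sum big_setU1. Qed.

Lemma betweenU1 x J j t :
  x \notin J -> between (x |: J) j t = ((j < x < t)%N + between J j t)%N.
Proof. by move=> xJ; rewrite /between !card_sub_sum big_setU1. Qed.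

Lemma below_eq0 J j : (forall x, x \in J -> (j <= x)%N) -> below J j = 0%N.
Proof.
move=> jJ; rewrite /below card_sub_sum big1 // => x /jJ.
by rewrite leqNgt => /negbTE->.
Qed.

Lemma ell_sum S T : ell S T = (\sum_(s in S) \sum_(t in T) (t < s))%N.
Proof.
rewrite /ell -sum1_card (eq_bigl (fun p => [&& p.1 \in S, p.2 \in T & (p.2 < p.1)%N])).
  rewrite big_mkcond /=.
  rewrite -(pair_big xpredT xpredT (fun s t => if [&& s \in S, t \in T & (t < s)%N] then 1%N else 0%N)) /=.
  rewrite [RHS]big_mkcond; apply: eq_bigr => s _; case: (s \in S) => /=; last by rewrite big1.
  by rewrite [RHS]big_mkcond; apply: eq_bigr => t _; case: (t \in T) => //=; case: (t < s)%N.
by move=> p; rewrite !inE andbA.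
Qed.

Lemma ellU1l x S T : x \notin S -> ell (x |: S) T = (below T x + ell S T)%N.
Proof. by move=> xS; rewrite !ell_sum big_setU1 //= /below card_sub_sum. Qed.

Lemma ellU1r x S T : x \notin T -> ell S (x |: T) = (above S x + ell S T)%N.
Proof.
move=> xT; rewrite !ell_sum /above card_sub_sum -big_split /=.
by apply: eq_bigr => s _; rewrite big_setU1.
Qed.

(** Replaces positions in an enumeration by counts, which behave well when elements are added or
    removed. *)
Lemma enum_val_below (U : {set 'I_n}) (l : 'I_#|U|) : below U (enum_val l) = l.
Proof.
have szU : (l < size (enum U))%N by rewrite -cardE.
have eqU x : x \in U -> (x < enum_val l)%N = (index x (enum U) < l)%N.
  move=> xU; have ix : (index x (enum U) < size (enum U))%N by rewrite index_mem mem_enum.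
  have := sorted_enum U => /(sorted_ltn_nth ltn_trans 0%N) mono.
  have val_nth (m : nat) : (m < size (enum U))%N -> nth 0%N (map val (enum U)) m = nth (enum_val l) (enum U) m.
    by move=> lt_m; rewrite (nth_map (enum_val l)).
  have le : (enum_val l = nth (enum_val l) (enum U) l :> 'I_n).
    by rewrite {1}(enum_val_nth (enum_val l)).
  have xe : x = nth (enum_val l) (enum U) (index x (enum U)) by rewrite nth_index ?mem_enum.
  case: (ltngtP (index x (enum U)) l) => h.
  - have := mono _ _ _ _ h; rewrite !inE !size_map => /(_ ix szU).
    by rewrite !val_nth // -xe -le.
  - have := mono _ _ _ _ h; rewrite !inE !size_map => /(_ szU ix).
    by rewrite !val_nth // -xe -le => h'; apply/negbTE; rewrite -leqNgt ltnW.
  - by rewrite {1}xe h -le ltnn.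
rewrite /below; transitivity #|[set x in U | (index x (enum U) < l)%N]|.
  by apply: eq_card => x; rewrite !inE; case xU: (x \in U) => //=; rewrite eqU.
rewrite card_sub_sum -big_enum /=.
transitivity (\sum_(i < size (enum U)) (i < l))%N.
  rewrite (big_nth (enum_val l)) big_mkord; apply: eq_bigr => i _.
  by rewrite index_uniq ?enum_uniq.
rewrite -(big_mkord xpredT (fun i => nat_of_bool (i < l)%N)).
rewrite (big_cat_nat (n := l)) //=; last exact: ltnW.
rewrite big_nat_cond (eq_bigr (fun=> 1%N)); last by move=> i /andP[/andP[_ ->]].
rewrite -big_nat_cond sum_nat_const_nat subn0 muln1.
rewrite big_nat_cond big1 ?addn0 // => i /andP[/andP[li _] _].
by rewrite ltnNge li.
Qed.

Lemma above_split (D : {set 'I_n}) j t : (j < t)%N ->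
  above D j = (above D t + between D j t + (t \in D))%N.
Proof.
move=> jt; have -> : (t \in D : nat) = (\sum_(x in D) (x == t))%N.
  rewrite -card_sub_sum; case: (boolP (t \in D)) => tD.
    rewrite /= -(cards1 t); apply: eq_card => x; rewrite !inE.
    by case: eqP => [->|]; rewrite ?tD ?andbF.
  apply/esym/eqP; rewrite cards_eq0; apply/eqP/setP=> x; rewrite !inE.
  by case: eqP => [->|]; rewrite ?(negbTE tD) ?andbF.
rewrite /above /between !card_sub_sum -!big_split /=; apply: eq_bigr => x _.
rewrite -(inj_eq val_inj) /=; lia.
Qed.

Lemma below_split P j t : j \in P -> (j < t)%N ->
  below P t = (below P j + between P j t).+1.
Proof.
move=> jP jt; rewrite -(setD1K jP).
have jN : j \notin P :\ j by rewrite setD11.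
rewrite !belowU1 // betweenU1 // ltnn jt !add0n add1n /below /between !card_sub_sum.
congr _.+1; rewrite -big_split; apply: eq_bigr => x.
rewrite !inE -(inj_eq val_inj) /=; lia.
Qed.

End OrdinalSets.

(** * Quantum integers and the coefficients xi *)

Section Scalars.
Variables (k : fieldType) (q : k).
Hypothesis q0 : q != 0.

Lemma oppq_neq0 : - q != 0. Proof. by rewrite oppr_eq0. Qed.
#[local] Hint Resolve oppq_neq0 : core.

Lemma qhatV : qhat q^-1 = - qhat q.
Proof. by rewrite /qhat invrK opprB. Qed.

Lemma qintV d : qint q^-1 d = qint q d.
Proof.
rewrite /qint (reindex_inj rev_ord_inj); apply: eq_bigr => i _ /=.
rewrite -invrN exprz_inv; congr (_ ^ _).
have := ltn_ord i; lia.
Qed.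

Lemma qint_sum h :
  \sum_(j < h) (- q) ^ ((2 * j)%N%:Z - (h%:Z - 1)) = qint q h.
Proof.
rewrite /qint (reindex_inj rev_ord_inj); apply: eq_bigr => i _ /=.
by congr (_ ^ _); have := ltn_ord i; lia.
Qed.

(** Since qhat q * (- q) = 1 - q^2, the j-th summand is (-q)^(2j) - (-q)^(2j+2). *)
Lemma telescope h :
  (- q) ^ (2 * h)%N%:Z + \sum_(j < h) qhat q * (- q) ^ ((2 * j)%N%:Z + 1) = 1.
Proof.
elim: h => [|h IHh]; first by rewrite big_ord0 muln0 expr0z addr0.
rewrite big_ord_recr /= addrCA -[RHS]IHh addrC; congr (_ + _).
rewrite mulnS PoszD addrC !expfzDr // expr1z /qhat.
rewrite -[(- q) ^ 2%N]/((- q) ^+ 2).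
field.
exact: q0.
Qed.

Section Xi.
Variable n : nat.
Implicit Types (t j x : 'I_n) (U V J : {set 'I_n}).

(** The ranks of the elements of [J] run once through 0, ..., #|J| - 1. *)
Lemma sum_below J (f : nat -> k) :
  \sum_(j in J) f (below J j) = \sum_(i < #|J|) f i.
Proof.
rewrite big_enum_val.
by apply: eq_bigr => i _; rewrite enum_val_below.
Qed.

Lemma xi_prod U V :
  xi q U V = \prod_(u in U) qint q (#|[set v in V | (v <= u)%N]| - below U u).
Proof.
rewrite [RHS]big_enum_val.
by apply: eq_bigr => i _; rewrite enum_val_below.
Qed.

(** This is [xi] with each argument of [qint] lowered by one. That shift occurs both when a smaller
    letter joins [U] ([xi_U1]) and when a smaller letter leaves [V] ([xi_D1]). *)
Definition xi_pred U V : k :=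
  \prod_(u in U) qint q (#|[set v in V | (v <= u)%N]| - (below U u).+1).

Lemma xi_U1 t U V : (forall x, x \in U -> (t < x)%N) -> t \notin V ->
  xi q (t |: U) V = qint q (below V t) * xi_pred U V.
Proof.
move=> tU tV.
have tNU : t \notin U by apply/negP => /tU; rewrite ltnn.
rewrite xi_prod big_setU1 //=; congr (_ * _).
  rewrite (@below_eq0 _ (t |: U)) ?subn0.
    congr qint; apply: eq_card => x; rewrite !inE.
    case: (eqVneq x t) => [->|xt]; first by rewrite (negbTE tV).
    by rewrite ltn_neqAle (inj_eq val_inj) xt.
  by move=> x; rewrite !inE => /orP[/eqP->//|/tU/ltnW].
apply: eq_bigr => u uU; congr qint.
by rewrite belowU1 // (tU _ uU) add1n.
Qed.

Lemma xi_D1 j U V : (forall x, x \in U -> (j < x)%N) -> j \in V ->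
  xi q U (V :\ j) = xi_pred U V.
Proof.
move=> jU jV; rewrite xi_prod; apply: eq_bigr => u uU; congr qint.
rewrite -[in RHS](setD1K jV) !card_sub_sum big_setU1 ?setD11 //=.
by rewrite (ltnW (jU _ uU)) add1n subSS.
Qed.

Lemma xi_exchange t j U V :
    (forall x, x \in U -> (t < x)%N) -> (j < t)%N -> j \in V -> t \notin V ->
  xi q U (t |: (V :\ j)) = xi q U V.
Proof.
move=> tU jt jV tV; rewrite !xi_prod; apply: eq_bigr => u uU.
rewrite -[in RHS](setD1K jV) !card_sub_sum !big_setU1 ?setD11 //=; last first.
  by rewrite !inE negb_and tV orbT.
by rewrite (ltnW (tU _ uU)) (ltnW (ltn_trans jt (tU _ uU))).
Qed.

Lemma xiV U V : xi q^-1 U V = xi q U V.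
Proof. by apply: eq_bigr => l _; rewrite qintV. Qed.

End Xi.
End Scalars.

(** * The reordering coefficients *)

Section Kernel.
Variables (k : fieldType) (q : k) (n : nat).
Hypothesis q0 : q != 0.
Implicit Types (t j x : 'I_n) (D U V P T J N : {set 'I_n}).

Let q0' : - q != 0. Proof. by rewrite oppr_eq0. Qed.

(** The common shape of lambda and mu: the latter arises at q, the former at q^-1, and [D] becomes
    the auxiliary set in [calLnat] or [calL]. *)
Definition kweight D U V : k :=
  qhat q ^+ #|U| * (- q) ^ ((ell D U)%:Z - (ell D V)%:Z) * xi q U V.

Lemma kweight_U1 t D U V : t \notin D -> (forall x, x \in U -> (t < x)%N) ->
  (- q) ^+ below V t * kweight (t |: D) U V = kweight D U V.
Proof.
move=> tD tU; rewrite /kweight !ellU1l // (@below_eq0 _ U); last by move=> x /tU/ltnW.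
rewrite exprnP; have -> : forall a b c d : k, a * (b * c * d) = b * (a * c) * d.
  by move=> *; ring.
by rewrite -expfzDr //; congr (_ * (_ ^ _) * _); lia.
Qed.

(** On the right, [j] enters only through its rank in [V], as an even power of -q; summation over
    [j] can then produce a quantum integer. *)
Lemma kweight_drop t j D U V :
    (forall x, x \in U -> (t < x)%N) -> (j < t)%N -> j \in D -> j \in V ->
    t \notin D -> t \notin V ->
  qhat q * (- q) ^ ((below V j)%:Z - (between D j t)%:Z)
      * kweight (t |: (D :\ j)) U (V :\ j) =
  (- q) ^ ((2 * below V j)%N%:Z - ((below V t)%:Z - 1)) *
    (qhat q ^+ #|U|.+1 * (- q) ^ ((ell D (t |: U))%:Z - (ell D V)%:Z)
      * xi_pred q U V).
Proof.
move=> tU jt jD jV tD tV; rewrite /kweight.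
have jU x : x \in U -> (j < x)%N by move=> /tU; apply: ltn_trans.
have tNU : t \notin U by apply/negP => /tU; rewrite ltnn.
rewrite (xi_D1 _ jU jV) exprS.
have -> : forall a b c d e : k, a * b * (c * d * e) = (a * c * e) * (b * d).
  by move=> *; ring.
have -> : forall a b c d e : k, b * (a * c * d * e) = (a * c * e) * (b * d).
  by move=> *; ring.
rewrite -!expfzDr //; congr (_ * (_ ^ _)).
rewrite -[in RHS](setD1K jD) -[in RHS](setD1K jV).
have jD' : j \notin D :\ j by rewrite setD11.
have jV' : j \notin V :\ j by rewrite setD11.
have tD' : t \notin D :\ j by rewrite !inE negb_and tD orbT.
rewrite -[in LHS](setD1K jD) -[in X in below X _](setD1K jV) setU1K //.
rewrite !(ellU1l, ellU1r, belowU1, betweenU1, aboveU1, ltnn, jt) //=.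
rewrite (above_split (D :\ j) jt) (negbTE tD').
rewrite (leq_gtF (ltnW jt)) (below_eq0 (J := U) (j := t)); last by move=> x /tU/ltnW.
rewrite (below_eq0 (J := U) (j := j)); last by move=> x /jU/ltnW.
rewrite ?addn0 ?add0n ?PoszD; ring.
Qed.

(** Both [j] and [t] lie below [U], so replacing one by the other in [V] does not affect [xi]. What
    is left of [j] is a summand of [telescope]. *)
Lemma kweight_exchange t j D U V :
    (forall x, x \in U -> (t < x)%N) -> (j < t)%N -> j \in D -> j \in V ->
    t \in D -> t \notin V ->
  qhat q * (- q) ^ ((below V j)%:Z - (between D j t)%:Z)
      * kweight (D :\ j) U (t |: (V :\ j)) =
  qhat q * (- q) ^ ((2 * below V j)%N%:Z + 1) * kweight D U V.
Proof.
move=> tU jt jD jV tD tV; rewrite /kweight.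
have jU x : x \in U -> (j < x)%N by move=> /tU; apply: ltn_trans.
rewrite (xi_exchange _ tU jt jV tV).
have -> : forall a b c d e : k, a * b * (c * d * e) = (a * c * e) * (b * d).
  by move=> *; ring.
have -> : forall a b c d e : k, a * b * (c * d * e) = (a * c * e) * (b * d).
  by move=> *; ring.
rewrite -!expfzDr //; congr (_ * (_ ^ _)).
have jD' : j \notin D :\ j by rewrite setD11.
have jV' : j \notin V :\ j by rewrite setD11.
have tD' : t \in D :\ j by rewrite !inE tD andbT; apply: contraTneq jt => ->; rewrite ltnn.
have tV' : t \notin V :\ j by rewrite !inE negb_and tV orbT.
rewrite -[in RHS](setD1K jD) -[in RHS](setD1K jV).
rewrite -[X in between X _ _](setD1K jD) -[in X in below X _](setD1K jV).
rewrite !(ellU1l, ellU1r, belowU1, betweenU1, aboveU1, ltnn, jt) //=.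
rewrite (above_split (D :\ j) jt) tD'.
rewrite (below_eq0 (J := U) (j := j)); last by move=> x /jU/ltnW.
rewrite -[nat_of_bool true]/1%N ?addn0 ?add0n ?PoszD; ring.

Qed.

(** The invariants of reordering b_P a_T into a_J b_N: each index keeps its multiplicity, and the
    number of a's is constant. *)
Definition admissible P T J N :=
  [&& J :&: N == P :&: T, J :|: N == P :|: T & #|J| == #|T|].

Definition kernel P T J N : k :=
  if admissible P T J N
  then q ^+ #|J :&: N| *
       kweight ((P :|: T) :\: (P :&: T) :\: (T :\: J)) (T :\: J) (J :\: T)
  else 0.

Lemma admissibleP P T J N :
  reflect [/\ forall x, (x \in J) && (x \in N) = (x \in P) && (x \in T),
              forall x, (x \in J) || (x \in N) = (x \in P) || (x \in T)
            & #|J| = #|T|]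
          (admissible P T J N).
Proof.
apply: (iffP and3P) => [[/eqP/setP hI /eqP/setP hU /eqP hc]|[hI hU hc]].
  by split=> // x; [have := hI x | have := hU x]; rewrite !inE.
by split; apply/eqP => //; apply/setP=> x; rewrite !inE ?hI ?hU.
Qed.

Lemma admissible_card P T J N : admissible P T J N -> #|N| = #|P|.
Proof.
case/and3P=> /eqP hI /eqP hU /eqP cJT; have := cardsUI J N.
by rewrite hI hU cardsUI cJT => /eqP; rewrite addnC eqn_add2l => /eqP.
Qed.

Lemma eq_below (A B : {set 'I_n}) j :
  (forall x, (x < j)%N -> (x \in A) = (x \in B)) -> below A j = below B j.
Proof.
move=> AB; apply: eq_card => x; rewrite !inE.
by case xj: (x < j)%N; rewrite ?andbF // AB.
Qed.

Lemma kernel_set0 P J N : kernel P set0 J N = ((J == set0) && (N == P))%:R.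
Proof.
rewrite /kernel /admissible cards0 cards_eq0 !setI0 !setU0.
case: (eqVneq J set0) => [->|_]; last by rewrite !andbF.
rewrite set0I set0U eqxx andbT; case: (eqVneq N P) => //= _.
rewrite cards0 mul1r !set0D /kweight cards0 mul1r subrr expr0z mul1r.
by rewrite xi_prod big_set0.
Qed.

(** * Recursion of the coefficients on the smallest letter of T *)

Section KernelStep.
Variables (t : 'I_n) (P T J N : {set 'I_n}).
Hypothesis tT : forall x, x \in T -> (t < x)%N.

Let tNT : t \notin T. Proof. by apply/negP => /tT; rewrite ltnn. Qed.

(** Mirrors b_P a_t = q a_t b_P; the power of -q sorts a_t into its place in a_J. *)
Lemma kernel_step_mem : t \in P ->
  kernel P (t |: T) J N =
    (if t \in J then (- q) ^+ below J t * (q * kernel P T (J :\ t) N) else 0).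
Proof.
move=> tP; rewrite /kernel.
have [tJ|tJ] := boolP (t \in J); last first.
  case: ifP => // /admissibleP[hI _ _].
  by have := hI t; rewrite !inE eqxx tP (negbTE tJ).
have adm : admissible P (t |: T) J N = admissible P T (J :\ t) N.
  apply/admissibleP/admissibleP => -[hI hU hc]; split.
  - move=> x; have := hI x; rewrite !inE.
    by case: eqVneq => //= ->; rewrite (negbTE tNT) andbF.
  - move=> x; have := hU x; have := hI x; rewrite !inE.
    by case: eqVneq => //= ->; rewrite tJ tP /= => ->.
  - by have := cardsD1 t J; rewrite tJ hc cardsU1 tNT => -[].
  - move=> x; have := hI x; have := hU x; rewrite !inE.
    by case: eqVneq => //= ->; rewrite tJ tP /= => ->.
  - move=> x; have := hU x; rewrite !inE.
    by case: eqVneq => //= ->; rewrite tJ tP.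
  - by rewrite cardsU1 tNT -hc (cardsD1 t) tJ.
rewrite adm; case: ifP; last by rewrite !mulr0.
rewrite -adm => /admissibleP[hI hU hc].
have tN : t \in N by have := hI t; rewrite !inE tJ tP eqxx.
have -> : #|J :&: N| = #|(J :\ t) :&: N|.+1.
  rewrite (cardsD1 t) !inE tJ tN add1n; congr _.+1; apply: eq_card => x.
  by rewrite !inE andbA.
have -> : T :\: (J :\ t) = (t |: T) :\: J.
  apply/setP=> x; rewrite !inE.
  by case: (eqVneq x t) => [->|]; rewrite ?tJ ?(negbTE tNT).
have -> : J :\ t :\: T = J :\: (t |: T).
  apply/setP=> x; rewrite !inE.
  by case: (eqVneq x t) => [->|]; rewrite ?andbF.
set D := _ :\: _ :\: _; set D' := _ :\: _ :\: _; have -> : D' = t |: D.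
  apply/setP=> x; rewrite /D /D' !inE.
  by case: (eqVneq x t) => [->|]; rewrite ?tJ ?tP ?(negbTE tNT).
have tU x : x \in (t |: T) :\: J -> (t < x)%N.
  by rewrite !inE; case: (eqVneq x t) => [->|_]; [rewrite tJ | case/andP=> _ /tT].
rewrite -(@kweight_U1 t D _ (J :\: (t |: T)) _ tU); last by rewrite /D !inE tP eqxx tJ.
rewrite exprS (@eq_below J (J :\: (t |: T))); last first.
  move=> x xt; rewrite !inE; case: (eqVneq x t) xt => [->|_]; first by rewrite ltnn.
  by case: (boolP (x \in T)) => // /tT xt /(ltn_trans xt); rewrite ltnn.
by ring.
Qed.

(** The branch in which b_P a_t yields a_j times b of [t |: (P :\ j)]. The power of [between] is the
    coefficient in [aprod_mul], and that of [below] sorts a_j into its place in a_J. *)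
Definition exchange_term j : k :=
  qhat q * (- q) ^ ((below J j)%:Z - (between P j t)%:Z)
    * kernel (t |: (P :\ j)) T (J :\ j) N.

Section Exchange.
Hypothesis tP : t \notin P.

Lemma admissible_exchange j : j \in P -> (j < t)%N -> j \in J ->
  admissible (t |: (P :\ j)) T (J :\ j) N = admissible P (t |: T) J N.
Proof.
move=> jP jt jJ.
have jNt : (j == t) = false by apply: contraTF jt => /eqP->; rewrite ltnn.
have jT : (j \in T) = false by apply: contraTF jt => /tT; rewrite -leqNgt => /ltnW.
have tNj : (t == j) = false by rewrite eq_sym.
apply/admissibleP/admissibleP => -[hI hU hc]; split.
- move=> x; have := hU x; have := hI x; rewrite !inE.
  have [->|xj] := eqVneq x j; first by rewrite jP jJ jT jNt; case: (j \in N).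
  have [->|//] := eqVneq x t; rewrite (negbTE tP) (negbTE tNT) => -> _.
  by rewrite andbF.
- move=> x; have := hU x; rewrite !inE.
  have [->|xj] := eqVneq x j; first by rewrite jP jJ.
  by have [->|//] := eqVneq x t; rewrite orbT.
- by rewrite cardsU1 tNT -hc (cardsD1 j J) jJ.
- move=> x; have := hU x; have := hI x; rewrite !inE.
  have [->|xj] := eqVneq x j; first by rewrite jP jJ jT jNt; case: (j \in N).
  by have [->|//] := eqVneq x t; rewrite (negbTE tP) (negbTE tNT).
- move=> x; have := hU x; have := hI x; rewrite !inE.
  have [->|xj] := eqVneq x j; first by rewrite jP jJ jT jNt; case: (j \in N).
  by have [->|//] := eqVneq x t; rewrite orbT.
- by have := cardsD1 j J; rewrite jJ hc cardsU1 tNT => -[].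
Qed.

(** Any j < t in [J] lies in [P], because [T] is above [t]. The sum therefore runs over all elements
    of [J] below [t], and can be indexed by rank. *)
Lemma sum_exchange (c : k) (f : nat -> k) : admissible P (t |: T) J N ->
    (forall j, j \in J -> (j < t)%N ->
      exchange_term j = c * f (below J j)) ->
  \sum_(j in P | (j < t)%N && (j \in J)) exchange_term j =
  c * \sum_(i < below J t) f i.
Proof.
move=> /admissibleP[hI hU hc] ef.
rewrite -sum_below // mulr_sumr.
rewrite (eq_bigl (fun j => j \in [set x in J | (x < t)%N])) => [|j].
  apply: eq_bigr => j; rewrite inE => /andP[jJ jt]; rewrite ef //.
  congr (_ * f _); apply: eq_below => x xj; rewrite inE.
  by rewrite (ltn_trans xj jt) andbT.
rewrite !inE; case: (boolP (j \in J)) => jJ; rewrite ?andbF //= andbT.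
case: (boolP (j < t)%N) => jt; rewrite ?andbF ?andbT //.
have := hU j; rewrite jJ !inE; case: (j \in P) => //=.
case: eqP jt => [->|_ jt]; first by rewrite ltnn.
by case: (boolP (j \in T)) => // /tT /(ltn_trans jt); rewrite ltnn.
Qed.

Lemma sum_exchange0 : ~~ admissible P (t |: T) J N ->
  \sum_(j in P | (j < t)%N && (j \in J)) exchange_term j = 0.
Proof.
move=> nadm; rewrite big1 // => j /and3P[jP jt jJ].
by rewrite /exchange_term /kernel admissible_exchange // (negbTE nadm) mulr0.
Qed.

(** Here [t] joins the first argument of [xi], which gains the factor [qint q (below V t)]. The
    exchange branches add up to exactly this quantum integer. *)
Lemma kernel_step_drop : t \notin J ->
  kernel P (t |: T) J N = \sum_(j in P | (j < t)%N && (j \in J)) exchange_term j.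
Proof.
move=> tJ; have [adm|nadm] := boolP (admissible P (t |: T) J N); last first.
  by rewrite sum_exchange0 // /kernel (negbTE nadm).
have /admissibleP[hI hU hc] := adm.
set U := T :\: J; set V := J :\: T.
set D := (P :|: (t |: T)) :\: (P :&: (t |: T)) :\: ((t |: T) :\: J).
have tU x : x \in U -> (t < x)%N by rewrite inE => /andP[_ /tT].
have lowT x : (x < t)%N -> (x \in T) = false.
  by move=> xt; apply: contraTF xt => /tT; rewrite -leqNgt => /ltnW.
have belowV j : (j <= t)%N -> below V j = below J j.
  by move=> jt; apply: eq_below => x xj; rewrite inE lowT // (leq_trans xj).
have tD : t \notin D by rewrite !inE eqxx tJ.
have tV : t \notin V by rewrite !inE (negbTE tJ) andbF.
have eU : (t |: T) :\: J = t |: U.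
  by apply/setP=> x; rewrite !inE; case: (eqVneq x t) => [->|]; rewrite ?tJ.
have eV : J :\: (t |: T) = V.
  by apply/setP=> x; rewrite !inE; case: (eqVneq x t) => [->|]; rewrite ?(negbTE tJ) ?andbF.
(* The part of [exchange_term] common to all [j]. *)
pose c := q ^+ #|J :&: N| * (qhat q ^+ #|U|.+1 *
  (- q) ^ ((ell D (t |: U))%:Z - (ell D V)%:Z) * xi_pred q U V).
rewrite (@sum_exchange c (fun i => (- q) ^ ((2 * i)%N%:Z - ((below J t)%:Z - 1)))) //.
  rewrite (qint_sum q0) /kernel adm -/D eU eV /kweight xi_U1 // belowV // /c.
  rewrite cardsU1 inE (negbTE tNT) andbF /= add1n.
  by ring.
move=> j jJ jt.
have jP : j \in P.
  have := hU j; rewrite jJ !inE lowT // orbF.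
  by case: eqVneq jt => [->|_ _ /esym]; rewrite ?ltnn ?orbF.
have jNt : (j == t) = false by apply: contraTF jt => /eqP->; rewrite ltnn.
have jN : j \notin N by have := hI j; rewrite jJ !inE jNt lowT // andbF /= => ->.
rewrite /exchange_term /kernel admissible_exchange // adm.
have -> : (J :\ j) :&: N = J :&: N.
  by apply/setP=> x; rewrite !inE; case: eqVneq => //= ->; rewrite (negbTE jN) andbF.
have -> : T :\: (J :\ j) = U.
  by apply/setP=> x; rewrite !inE; case: eqVneq => //= ->; rewrite lowT // andbF.
have -> : J :\ j :\: T = V :\ j.
  by apply/setP=> x; rewrite !inE; case: eqVneq; rewrite ?andbF.
have -> : ((t |: (P :\ j)) :|: T) :\: ((t |: (P :\ j)) :&: T) :\: U = t |: (D :\ j).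
  apply/setP=> x; rewrite /D !inE.
  have [->|xt] := eqVneq x t; first by rewrite (negbTE tNT) !andbF.
  by have [->|//] := eqVneq x j; rewrite lowT // jJ jP.
have -> : between P j t = between D j t.
  apply: eq_card => x; rewrite !inE; case: (boolP (j < x < t)%N); rewrite ?andbF ?andbT //.
  case/andP=> jx xt; rewrite lowT //.
  by case: eqVneq xt => [->|_ _]; rewrite ?ltnn //=; case: (x \in P); case: (x \in J).
rewrite -!belowV //; last exact: ltnW.
rewrite mulrCA kweight_drop //.
- by rewrite /c; ring.
- by rewrite !inE jNt jJ jP lowT.
- by rewrite !inE jJ lowT.
Qed.

(** With h = [below J t], the direct branch accounts for the fraction (-q)^(2h) of the coefficient
    and the exchange branches for the other terms of [telescope]. *)
Lemma kernel_step_stay : t \in J ->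
  kernel P (t |: T) J N =
    (- q) ^+ below J t * kernel P T (J :\ t) N +
    \sum_(j in P | (j < t)%N && (j \in J)) exchange_term j.
Proof.
move=> tJ.
have adm_eq : admissible P T (J :\ t) N = admissible P (t |: T) J N.
  apply/admissibleP/admissibleP => -[hI hU hc]; split.
  - move=> x; have := hU x; have := hI x; rewrite !inE.
    have [->|//] := eqVneq x t; rewrite (negbTE tP) (negbTE tNT) tJ.
    by case: (t \in N).
  - move=> x; have := hU x; rewrite !inE.
    by have [->|//] := eqVneq x t; rewrite orbT tJ.
  - by rewrite cardsU1 tNT -hc (cardsD1 t J) tJ.
  - move=> x; have := hU x; have := hI x; rewrite !inE.
    by have [->|//] := eqVneq x t; rewrite (negbTE tP) (negbTE tNT).
  - move=> x; have := hU x; have := hI x; rewrite !inE.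
    have [->|//] := eqVneq x t; rewrite (negbTE tP) (negbTE tNT) tJ.
    by case: (t \in N).
  - by have := cardsD1 t J; rewrite tJ hc cardsU1 tNT => -[].
have [adm|nadm] := boolP (admissible P (t |: T) J N); last first.
  by rewrite sum_exchange0 // /kernel adm_eq (negbTE nadm) mulr0 addr0.
have /admissibleP[hI hU hc] := adm.
set U := (t |: T) :\: J; set V := J :\: (t |: T).
set D := (P :|: (t |: T)) :\: (P :&: (t |: T)) :\: U.
have lowT x : (x < t)%N -> (x \in T) = false.
  by move=> xt; apply: contraTF xt => /tT; rewrite -leqNgt => /ltnW.
have tU x : x \in U -> (t < x)%N.
  by rewrite !inE; case: eqVneq => [->|_]; [rewrite tJ | case/andP=> _ /tT].
have belowV j : (j <= t)%N -> below V j = below J j.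
  move=> jt; apply: eq_below => x xj; rewrite !inE lowT ?(leq_trans xj) //.
  by case: eqVneq xj => [->|//]; rewrite ltnNge jt.
have tD : t \in D by rewrite !inE eqxx tJ (negbTE tP).
have tV : t \notin V by rewrite !inE eqxx.
have tN : (t \in N) = false by have := hI t; rewrite !inE tJ (negbTE tP).
pose c := kernel P (t |: T) J N.
have cE : c = q ^+ #|J :&: N| * kweight D U V by rewrite /c /kernel adm.
rewrite (@sum_exchange c (fun i => qhat q * (- q) ^ ((2 * i)%N%:Z + 1))) //; last first.
  move=> j jJ jt.
  have jP : j \in P.
    have := hU j; rewrite jJ !inE lowT // orbF.
    by case: eqVneq jt => [->|_ _ /esym]; rewrite ?ltnn ?orbF.
  have jNt : (j == t) = false by apply: contraTF jt => /eqP->; rewrite ltnn.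
  have tNj : (t == j) = false by rewrite eq_sym.
  have jN : j \notin N by have := hI j; rewrite jJ !inE jNt lowT // andbF /= => ->.
  rewrite /exchange_term /kernel admissible_exchange // adm.
  have -> : (J :\ j) :&: N = J :&: N.
    by apply/setP=> x; rewrite !inE; case: eqVneq => //= ->; rewrite (negbTE jN) andbF.
  have -> : T :\: (J :\ j) = U.
    apply/setP=> x; rewrite !inE; have [->|] := eqVneq x j.
      by rewrite lowT // jNt !andbF.
    by have [->|] := eqVneq x t; rewrite ?tJ ?(negbTE tNT).
  have -> : J :\ j :\: T = t |: (V :\ j).
    apply/setP=> x; rewrite !inE.
    by have [->|] := eqVneq x t; rewrite ?tNj ?tJ ?tNT // andbCA.
  have -> : ((t |: (P :\ j)) :|: T) :\: ((t |: (P :\ j)) :&: T) :\: U = D :\ j.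
    apply/setP=> x; rewrite /D !inE.
    have [->|xt] := eqVneq x t; first by rewrite tNj (negbTE tNT) tJ (negbTE tP).
    by have [->|//] := eqVneq x j; rewrite lowT // jJ jP.
  have -> : between P j t = between D j t.
    apply: eq_card => x; rewrite !inE; case: (boolP (j < x < t)%N); rewrite ?andbF ?andbT //.
    case/andP=> jx xt; rewrite lowT //.
    by case: eqVneq xt => [->|_ _]; rewrite ?ltnn //=; case: (x \in P); case: (x \in J).
  rewrite -!belowV //; last exact: ltnW.
  rewrite mulrCA kweight_exchange //.
  - by rewrite cE; ring.
  - by rewrite !inE jNt jJ jP lowT.
  - by rewrite !inE jNt jJ lowT.
(* Write the coefficient as c * 1 and expand 1 by [telescope]; the two parts then match the two
   kinds of branches. *)
rewrite -[kernel P (t |: T) J N]/c -[LHS]mulr1 -(telescope q0 (below J t)) mulrDr.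
congr (_ + _); rewrite /kernel adm_eq adm.
have -> : (J :\ t) :&: N = J :&: N.
  by apply/setP=> x; rewrite !inE; case: eqVneq => //= ->; rewrite tN andbF.
have -> : T :\: (J :\ t) = U.
  by apply/setP=> x; rewrite !inE; have [->|] := eqVneq x t; rewrite ?tJ ?(negbTE tNT).
have -> : J :\ t :\: T = V.
  by apply/setP=> x; rewrite !inE; have [->|] := eqVneq x t; rewrite ?andbF.
rewrite cE; set D' := _ :\: _ :\: _.
have -> : D = t |: D'.
  apply/setP=> x; rewrite /D /D' !inE.
  by have [->|//] := eqVneq x t; rewrite tJ (negbTE tP).
rewrite -(@kweight_U1 t D' _ _ _ tU); last by rewrite /D' !inE (negbTE tP) (negbTE tNT) /= !andbF.
rewrite belowV // mul2n -addnn PoszD expfzDr // -exprnP; by ring.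
Qed.

End Exchange.
End KernelStep.
End Kernel.

(** * Braided pairs of quantum exterior algebras *)

Section Braided.
Variables (k : fieldType) (n : nat).
Implicit Types (t j x p : 'I_n) (P T J N : {set 'I_n}).

Section BraidedPairs.
Variables (q : k) (G : algType k).

Record q_exterior (a : 'I_n -> G) : Prop := QExterior {
  ext_sqr t : a t * a t = 0;
  ext_anti p t : (p < t)%N -> a t * a p = (- q) *: (a p * a t) }.

Record braided (a b : 'I_n -> G) : Prop := Braided {
  braided_extl : q_exterior a;
  braided_extr : q_exterior b;
  braided_eq t : b t * a t = q *: (a t * b t);
  braided_lt p t : (p < t)%N ->
    b p * a t = a t * b p + qhat q *: (a p * b t);
  braided_gt p t : (p < t)%N -> b t * a p = a p * b t }.

Definition aprod (a : 'I_n -> G) J : G := \prod_(i <- enum J) a i.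

Lemma aprod0 a : aprod a set0 = 1.
Proof. by rewrite /aprod enum_set0 big_nil. Qed.

Lemma aprodU1 a t T : (forall x, x \in T -> (t < x)%N) ->
  aprod a (t |: T) = a t * aprod a T.
Proof. by move=> tT; rewrite /aprod enum_setU1_min // big_cons. Qed.

End BraidedPairs.

(** * Reordering b_P a_T *)

Section Reorder.
Variables (q : k) (G : algType k).
Hypothesis q0 : q != 0.

Section Exterior.
Variables (a : 'I_n -> G).
Hypothesis ext_a : q_exterior q a.

Lemma mul_aprod j J : a j * aprod a J =
  if j \in J then 0 else (- q) ^+ below J j *: aprod a (j |: J).
Proof.
elim/set_min_ind: J => [|t T tT IHT].
  by rewrite inE aprod0 mulr1 /aprod setU0 enum_set1 big_seq1 below_eq0 ?scale1r // => x; rewrite inE.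
have tNT : t \notin T by apply/negP => /tT; rewrite ltnn.
rewrite aprodU1 // mulrA !inE; case: (ltngtP j t) => jt.
- have jN : (j == t) = false by apply: contraTF jt => /eqP->; rewrite ltnn.
  have jT x : x \in t |: T -> (j < x)%N.
    by rewrite !inE => /orP[/eqP->|/tT]//; apply: ltn_trans.
  have -> : (j \in T) = false by apply/negP => jT'; have := jT j; rewrite setU1r // ltnn => /(_ isT).
  rewrite jN below_eq0 => [|x /jT/ltnW//]; rewrite scale1r [RHS]aprodU1 //.
  by rewrite aprodU1 // mulrA.
- have jN : (j == t) = false by apply: contraTF jt => /eqP->; rewrite ltnn.
  rewrite (ext_anti ext_a) // -scalerAl -mulrA IHT jN /=.
  case: ifP => jT; first by rewrite mulr0 scaler0.
  rewrite -scalerAr scalerA belowU1 // jt exprS setUCA (@aprodU1 _ a t (j |: T)) // => x.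
  by rewrite !inE => /orP[/eqP->|/tT].
- by rewrite (val_inj jt) eqxx (ext_sqr ext_a) mul0r.
Qed.

Lemma aprod_mul_min t T : (forall x, x \in T -> (t < x)%N) ->
  aprod a T * a t = (- q) ^+ #|T| *: (a t * aprod a T).
Proof.
elim/set_min_ind: T => [|x T xT IHT] tT.
  by rewrite aprod0 mul1r mulr1 cards0 scale1r.
have xNT : x \notin T by apply/negP => /xT; rewrite ltnn.
rewrite aprodU1 // -mulrA IHT => [|y yT]; last by apply: tT; rewrite setU1r.
rewrite -scalerAr (mulrA (a x)) (@ext_anti _ _ _ ext_a t x); last by apply: tT; rewrite setU11.
by rewrite -scalerAl scalerA cardsU1 xNT exprSr mulrA.
Qed.

(** Products in the converse algebra are reversed products; the factor depends on the cardinality of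
    [T] only. *)
Lemma aprod_rev T : \prod_(i <- rev (enum T)) a i =
  (- q) ^+ (\sum_(i < #|T|) i) *: aprod a T.
Proof.
elim/set_min_ind: T => [|t T tT IHT].
  by rewrite enum_set0 big_nil cards0 big_ord0 scale1r aprod0.
have tNT : t \notin T by apply/negP => /tT; rewrite ltnn.
rewrite enum_setU1_min // rev_cons -cats1 big_cat big_seq1 /= IHT -scalerAl.
rewrite aprod_mul_min // scalerA -exprD aprodU1 //.
by rewrite cardsU1 tNT big_ord_recr.
Qed.

End Exterior.

Variables (a b : 'I_n -> G).
Hypothesis ab : braided q a b.

Let ext_a := braided_extl ab.
Let ext_b := braided_extr ab.

Lemma braided_lt_mul p t (z : G) : (p < t)%N ->
  b p * (a t * z) = a t * (b p * z) + qhat q *: (a p * (b t * z)).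
Proof.
by move=> pt; rewrite !mulrA (braided_lt ab pt) [LHS]mulrDl -scalerAl.
Qed.

(** Induction on the minimum p of the set. When p < t and t is not in P, every branch that puts a_p
    in front ends in the same monomial, and its total coefficient collapses by [telescope]. *)
Lemma aprod_mul P t : aprod b P * a t =
  if t \in P then q *: (a t * aprod b P)
  else a t * aprod b P +
    \sum_(j in P | (j < t)%N) (qhat q * (- q) ^ (- (between P j t)%:Z)) *:
       (a j * aprod b (t |: (P :\ j))).
Proof.
elim/set_min_ind: P => [|p P pP IHP].
  rewrite inE aprod0 mul1r mulr1 big1 ?addr0 // => j.
  by rewrite inE.
have pNP : p \notin P by apply/negP => /pP; rewrite ltnn.
rewrite (aprodU1 _ pP) -mulrA IHP !inE.
case: (ltngtP p t) => pt.
- have tNp : (t == p) = false by apply: contraTF pt => /eqP->; rewrite ltnn.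
  have pNt : (p == t) = false by rewrite eq_sym.
  rewrite tNp /=; case: (boolP (t \in P)) => tP.
    rewrite -scalerAr braided_lt_mul //.
    by rewrite (mul_aprod ext_b t) tP mulr0 scaler0 addr0.
  rewrite mulrDr braided_lt_mul // -addrA; congr (_ + _).
  have bigS (F : 'I_n -> G) : \sum_(j in p |: P | (j < t)%N) F j =
      F p + \sum_(j in P | (j < t)%N) F j.
    by rewrite !big_mkcondr big_setU1 //= pt.
  rewrite bigS setU1K // betweenU1 // ltnn /= add0n.
  rewrite (mul_aprod ext_b t) (negbTE tP) -scalerAr scalerA.
  set m := below P t.
  have btwm : between P p t = m.
    apply: eq_card => x; rewrite !inE.
    by case: (boolP (x \in P)) => // /pP ->.
  (* [A] is the monomial in which p is exchanged with t; [B] collects the branches where some j > p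
     was exchanged and b_p merely passes a_j. *)
  pose A := a p * aprod b (t |: P).
  pose B := \sum_(j in P | (j < t)%N)
     (qhat q * (- q) ^ (- (between (p |: P) j t)%:Z)) *:
       (a j * aprod b (t |: ((p |: P) :\ j))).
  have btwU j : j \in P -> between (p |: P) j t = between P j t.
    by move=> /pP pj; rewrite betweenU1 // (leq_gtF (ltnW pj)).
  have -> : b p * (\sum_(j in P | (j < t)%N)
       (qhat q * (- q) ^ (- (between P j t)%:Z)) *: (a j * aprod b (t |: (P :\ j)))) =
     B + (\sum_(j in P | (j < t)%N) qhat q * (qhat q * (- q) ^ (- (between P j t)%:Z)
              * (- q) ^+ below P j)) *: A.
    rewrite mulr_sumr scaler_suml -big_split /=; apply: eq_bigr => j /andP[jP jt].
    have pj := pP _ jP.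
    have jNt : (j == t) = false by apply: contraTF jt => /eqP->; rewrite ltnn.
    rewrite -scalerAr braided_lt_mul // scalerDr btwU //.
    congr (_ + _).
      rewrite -aprodU1.
        congr (_ *: (_ * aprod b _)); apply/setP=> x; rewrite !inE.
        have [->|xp] := eqVneq x p; last by rewrite ?orbF; case: (x == t).
        by rewrite pNt -(inj_eq val_inj) /= ltn_eqF.
      by move=> x; rewrite !inE => /orP[/eqP->//|/andP[_ /pP]].
    rewrite scalerA (mul_aprod ext_b) !inE eqxx jNt /=.
    rewrite -scalerAr scalerA.
    have -> : j |: (t |: (P :\ j)) = t |: P by rewrite setUCA setD1K.
    congr (_ *: _); rewrite -mulrA mulrCA; congr (_ * (_ * _ ^+ _)).
    rewrite belowU1 ?(leq_gtF (ltnW jt)); last by rewrite !inE (negbTE tP) andbF.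
    by apply: eq_below => x xj; rewrite !inE (_ : x != j) // -(inj_eq val_inj) ltn_eqF.
  rewrite -/A -/B addrCA -scalerDl addrC; congr (_ *: _ + _).
  rewrite btwm (eq_bigl (fun j => j \in [set x in P | (x < t)%N])); last first.
    by move=> j; rewrite inE.
  (* An element of rank i among the m elements of P below t has m - 1 - i of them above it. *)
  pose f i := qhat q * (qhat q * (- q) ^ (- (m%:Z - 1 - i%:Z)) * (- q) ^+ i).
  rewrite (eq_bigr (fun j => f (below [set x in P | (x < t)%N] j))).
    rewrite sum_below // -[#|_|]/m.
    rewrite -mulr_sumr -mulrDr; congr (_ * _).
    (* The target (-q)^(-m), multiplied by the expansion of 1, is the coefficient of [A] term by
       term. *)
    rewrite -[RHS]mulr1 -(telescope q0 m) mulrDr -expfzDr ?oppr_eq0 //.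
    congr (_ + _).
      by rewrite exprnP; congr (_ ^ _); lia.
    rewrite mulr_sumr; apply: eq_bigr => i _.
    rewrite exprnP -mulrA -expfzDr ?oppr_eq0 // [RHS]mulrCA -expfzDr ?oppr_eq0 //.
    by congr (_ * _ ^ _); lia.
  move=> j; rewrite inE => /andP[jP jt]; rewrite /f.
  congr (_ * (_ * _ ^ _ * _ ^+ _)).
    rewrite /m (below_split jP jt) (@eq_below _ P [set x in P | (x < t)%N] j) ?PoszD.
      by rewrite -addn1 PoszD; ring.
    by move=> x xj; rewrite inE (ltn_trans xj jt) andbT.
  by apply: eq_below => x xj; rewrite inE (ltn_trans xj jt) andbT.
- have pNt : (t == p) = false by apply: contraTF pt => /eqP->; rewrite ltnn.
  have tP : (t \in P) = false by apply: contraTF pt => /pP; rewrite -leqNgt => /ltnW.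
  rewrite tP pNt /= !big1 => [||j].
  - by rewrite !addr0 mulrA (braided_gt ab pt) mulrA.
  - move=> j; rewrite !inE => /andP[/orP[/eqP->|/pP/(ltn_trans pt)]].
      by rewrite ltnNge (ltnW pt).
    by rewrite ltnNge => /negbTE tj jt; rewrite ltnW in tj.
  - by case/andP=> /pP pj; rewrite ltnNge (ltnW (ltn_trans pt pj)).
- rewrite (val_inj pt) eqxx /=; have tP : (t \in P) = false by rewrite -(val_inj pt) (negbTE pNP).
  rewrite tP big1 ?addr0 => [|j].
    by rewrite mulrA (braided_eq ab) -scalerAl mulrA.
  by rewrite -(val_inj pt) => /andP[/pP pj]; rewrite ltnNge (ltnW pj).
Qed.

Lemma sum_set_insert j (H : {set 'I_n} -> G) :
  \sum_(J : {set 'I_n}) (if j \in J then 0 else H J) = \sum_(J : {set 'I_n}) (if j \in J then H (J :\ j) else 0).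
Proof.
rewrite -[RHS]big_mkcond [RHS](reindex_onto (fun J : {set 'I_n} => j |: J) (fun J : {set 'I_n} => J :\ j)) => [|J jJ]; last exact: setD1K.
rewrite [RHS]big_mkcond; apply: eq_bigr => J _; rewrite setU11 /=.
case: ifP => jJ; last by rewrite setU1K ?jJ ?eqxx.
by case: eqP => // JJ; move: jJ; rewrite -JJ setD11.
Qed.

Lemma mul_expansion j (c : {set 'I_n} -> {set 'I_n} -> k) :
  a j * (\sum_J \sum_N c J N *: (aprod a J * aprod b N)) =
  \sum_(J : {set 'I_n}) \sum_N (if j \in J then (- q) ^+ below J j * c (J :\ j) N else 0) *:
    (aprod a J * aprod b N).
Proof.
pose H (J : {set 'I_n}) := \sum_N ((- q) ^+ below J j * c J N) *: (aprod a (j |: J) * aprod b N).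
transitivity (\sum_(J : {set 'I_n}) (if j \in J then 0 else H J)).
  rewrite mulr_sumr; apply: eq_bigr => J _; rewrite mulr_sumr /H.
  case: ifP => jJ; [rewrite big1 // => N _ | apply: eq_bigr => N _];
    rewrite -scalerAr mulrA (mul_aprod ext_a) jJ.
    by rewrite mul0r scaler0.
  by rewrite -scalerAl scalerA mulrC.
rewrite sum_set_insert; apply: eq_bigr => J _; rewrite /H.
case: ifP => jJ; last by rewrite big1 // => N _; rewrite scale0r.
apply: eq_bigr => N _; rewrite setD1K //; congr ((_ ^+ _ * _) *: _).
by apply: eq_below => x xj; rewrite !inE -(inj_eq val_inj) /= ltn_eqF.
Qed.

(** Cross the minimum t of the set by [aprod_mul], then apply the induction hypothesis to the
    remaining a's, with P possibly changed. The coefficients obey the recursion proved for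
    [kernel]. *)
Lemma reorder P T : aprod b P * aprod a T =
  \sum_J \sum_N kernel q P T J N *: (aprod a J * aprod b N).
Proof.
elim/set_min_ind: T P => [|t T tT IHT] P.
  rewrite aprod0 mulr1 (bigD1 set0) //= (bigD1 P) //= kernel_set0 !eqxx scale1r.
  rewrite aprod0 mul1r !big1 ?addr0 // => [J J0|N NP].
    by rewrite big1 // => N _; rewrite kernel_set0 (negbTE J0) scale0r.
  by rewrite kernel_set0 (negbTE NP) andbF scale0r.
rewrite aprodU1 // mulrA aprod_mul; case: ifP => tP.
  rewrite -scalerAl -mulrA IHT mul_expansion scaler_sumr; apply: eq_bigr => J _.
  rewrite scaler_sumr; apply: eq_bigr => N _; rewrite scalerA kernel_step_mem //.
  by congr (_ *: _); case: ifP; rewrite ?mulr0 // mulrCA.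
rewrite [LHS]mulrDl -mulrA IHT mul_expansion mulr_suml.
pose c j J N := (qhat q * (- q) ^ (- (between P j t)%:Z)) *
  (if j \in J then (- q) ^+ below J j * kernel q (t |: (P :\ j)) T (J :\ j) N else 0).
rewrite [X in _ + X](_ : _ = \sum_J \sum_N (\sum_(j in P | (j < t)%N) c j J N) *:
    (aprod a J * aprod b N)); last first.
  transitivity (\sum_(j in P | (j < t)%N) \sum_J \sum_N c j J N *: (aprod a J * aprod b N)).
    apply: eq_bigr => j _; rewrite -scalerAl -mulrA IHT mul_expansion scaler_sumr.
    by apply: eq_bigr => J _; rewrite scaler_sumr; apply: eq_bigr => N _; rewrite scalerA.
  rewrite exchange_big; apply: eq_bigr => J _; rewrite exchange_big.
  by apply: eq_bigr => N _; rewrite scaler_suml.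
rewrite -big_split; apply: eq_bigr => J _ /=.
rewrite -big_split; apply: eq_bigr => N _ /=.
rewrite -scalerDl; congr (_ *: _).
have -> : \sum_(j in P | (j < t)%N) c j J N =
    \sum_(j in P | (j < t)%N && (j \in J)) exchange_term q t P T J N j.
  rewrite big_mkcond [RHS]big_mkcond; apply: eq_bigr => j _.
  rewrite andbA; case: andP => //= _; rewrite /c; case: ifP => _; rewrite ?mulr0 //.
  rewrite /exchange_term addrC expfzDr ?oppr_eq0 // exprnP; ring.
have [tJ|tJ] := boolP (t \in J).
  by rewrite kernel_step_stay ?tP.
by rewrite kernel_step_drop ?tP // add0r.
Qed.

End Reorder.
End Braided.

(** * Reordering a_T b_P through the converse algebra *)

Section ConverseAlgebra.
Variables (k : fieldType) (G : algType k).

HB.instance Definition _ := GRing.Zmodule_isLmodule.Build k G^c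
  (@scalerA k G) (@scale1r k G) (@scalerDr k G) (@scalerDl k G).

Fact conv_scalerAl (c : k) (u v : G^c) : c *: (u * v) = (c *: u) * v.
Proof. exact: (@scalerAr k G). Qed.
HB.instance Definition _ := GRing.Lmodule_isLalgebra.Build k G^c conv_scalerAl.

Fact conv_scalerAr (c : k) (u v : G^c) : c *: (u * v) = u * (c *: v).
Proof. exact: (@scalerAl k G). Qed.
HB.instance Definition _ := GRing.Lalgebra_isAlgebra.Build k G^c conv_scalerAr.

End ConverseAlgebra.

Section ConverseReorder.
Variables (k : fieldType) (n : nat) (q : k) (G : algType k).
Hypothesis q0 : q != 0.
Implicit Types (P T J N : {set 'I_n}).
Variables (a b : 'I_n -> G).
Hypothesis ab : braided q a b.

Lemma q_exterior_conv (c : 'I_n -> G) :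
  q_exterior q c -> q_exterior q^-1 (c : 'I_n -> G^c).
Proof.
case=> c2 cN; split=> [t|p t pt]; first exact: c2.
have h : c p * c t = - q^-1 *: (c t * c p).
  by rewrite (cN p t pt) scalerA mulrNN mulVf // scale1r.
exact: h.
Qed.

(** The extra term of [braided_lt] keeps its form under reversal because a_p b_t = b_t a_p for p <
    t, and [qhat] changes sign with q -> q^-1. *)
Lemma braided_conv : braided q^-1 (a : 'I_n -> G^c) (b : 'I_n -> G^c).
Proof.
case: ab => ea eb be bl bg; split; try exact: q_exterior_conv.
- move=> t; have h : a t * b t = q^-1 *: (b t * a t).
    by rewrite be scalerA mulVf // scale1r.
  exact: h.
- move=> p t pt; have h : a t * b p = b p * a t + qhat q^-1 *: (b t * a p).
    by rewrite bl // bg // qhatV scaleNr addrK.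
  exact: h.
- move=> p t pt; have h : a p * b t = b t * a p by rewrite bg.
  exact: h.
Qed.

Lemma reorder_conv P T : aprod a T * aprod b P =
  \sum_J \sum_N kernel q^-1 P T J N *: (aprod b N * aprod a J).
Proof.
have qV0 : q^-1 != 0 by rewrite invr_eq0.
have [ea eb _ _ _] := ab.
have convE (c : 'I_n -> G) J : q_exterior q c ->
    aprod (c : 'I_n -> G^c) J = (- q) ^+ (\sum_(i < #|J|) i) *: aprod c J.
  by move=> ec; rewrite -(aprod_rev ec) /aprod rev_prodr.
have H := @reorder _ _ _ _ qV0 _ _ braided_conv P T.
pose s m : k := (- q) ^+ (\sum_(i < m) i).
have s0 m : s m != 0 by rewrite expf_neq0 // oppr_eq0.
have H1 : (aprod (a : 'I_n -> G^c) T : G) * aprod (b : 'I_n -> G^c) P =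
  \sum_J \sum_N kernel q^-1 P T J N *:
     ((aprod (b : 'I_n -> G^c) N : G) * aprod (a : 'I_n -> G^c) J).
  exact: H.
(* Insert the reversal factors of a_T and b_P. They cancel at the end, since #|J| = #|T| and #|N| =
   #|P| on the support of [kernel]. *)
apply: (scalerI (s0 #|T|)); apply: (scalerI (s0 #|P|)).
move: H1; rewrite !convE // -!/(s _) -scalerAl -scalerAr scalerA mulrC -scalerA => ->.
rewrite !scaler_sumr; apply: eq_bigr => J _; rewrite !scaler_sumr; apply: eq_bigr => N _.
rewrite !convE // -!/(s _) -scalerAl -scalerAr !scalerA /kernel.
case: ifP; last by rewrite !(mulr0, mul0r) !scale0r.
move=> adm; case/and3P: (adm) => _ _ /eqP cJT.
by rewrite cJT (admissible_card adm); congr (_ *: _); ring.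
Qed.

End ConverseReorder.

(** * The coaction of quantum matrices *)

Section Coaction.
Variables (k : fieldType) (n : nat) (q : k) (G : algType k).
Hypothesis q0 : q != 0.
Implicit Types (t j m p i l : 'I_n) (P T I J N : {set 'I_n}).

(** Stated for any algebra, so that the relations can be used for the images of the generators in
    the model. *)
Record qmatrix (X : 'I_n -> 'I_n -> G) : Prop := QMatrix {
  qmatrix_col i l j : (i < l)%N -> X i j * X l j = q *: (X l j * X i j);
  qmatrix_row i j m : (j < m)%N -> X i j * X i m = q *: (X i m * X i j);
  qmatrix_comm i j l m : (i < l)%N -> (m < j)%N -> X i j * X l m = X l m * X i j;
  qmatrix_cross i j l m : (i < l)%N -> (j < m)%N ->
    X i j * X l m = X l m * X i j + qhat q *: (X i m * X l j) }.

Variable X : 'I_n -> 'I_n -> G.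
Hypothesis qX : qmatrix X.

Definition coact (a : 'I_n -> G) i : G := \sum_j X i j * a j.

Definition commX (a : 'I_n -> G) := forall i j t, GRing.comm (X i j) (a t).

(** The relations never mix different pairs of columns, so identities of double sums reduce to the
    diagonal and to single pairs j < m. *)
Lemma sum_pairs (F : 'I_n -> 'I_n -> G) :
  \sum_j \sum_m F j m = \sum_j F j j + \sum_(j : 'I_n) \sum_(m : 'I_n | (j < m)%N) (F j m + F m j).
Proof.
have split3 j : \sum_m F j m =
    F j j + (\sum_(m : 'I_n | (j < m)%N) F j m + \sum_(m : 'I_n | (m < j)%N) F j m).
  rewrite (bigD1 j) //= (bigID (fun m : 'I_n => (j < m)%N)) /=; congr (_ + (_ + _)).
    by apply: eq_bigl => m; rewrite -(inj_eq val_inj) /=; case: ltngtP.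
  by apply: eq_bigl => m; rewrite -(inj_eq val_inj) /=; case: ltngtP.
rewrite (eq_bigr _ (fun j _ => split3 j)) big_split /=; congr (_ + _).
rewrite big_split /= [X in _ + X](exchange_big_dep xpredT) //= -big_split /=.
by apply: eq_bigr => j _; rewrite -big_split.
Qed.

Lemma coactM (a c : 'I_n -> G) i l : commX a ->
  coact a i * coact c l = \sum_j \sum_m (X i j * X l m) * (a j * c m).
Proof.
move=> ca; rewrite /coact big_distrlr /=; apply: eq_bigr => j _; apply: eq_bigr => m _.
by rewrite -!mulrA; congr (_ * _); rewrite !mulrA ca.
Qed.

Lemma coact_ext (a : 'I_n -> G) : commX a -> q_exterior q a -> q_exterior q (coact a).
Proof.
move=> ca [a2 aN]; split=> [t|p t pt].
  rewrite coactM // sum_pairs big1 ?add0r => [|j _]; last by rewrite a2 mulr0.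
  rewrite big1 // => j _; rewrite big1 // => m jm.
  rewrite (qmatrix_row qX) // (aN _ _ jm) -scalerAl -scalerAr scaleNr.
  by rewrite addrN.
rewrite !coactM // !sum_pairs scalerDr; congr (_ + _).
  by rewrite !big1 ?scaler0 // => j _; rewrite a2 mulr0.
rewrite scaler_sumr; apply: eq_bigr => j _; rewrite scaler_sumr; apply: eq_bigr => m jm.
rewrite (aN _ _ jm) (qmatrix_cross qX pt jm) -(qmatrix_comm qX pt jm).
set x2 := X p m * X t j; set y := X t m * X p j; set w := a j * a m.
rewrite mulrDl -!(scalerAr, scalerAl) !scalerDr !scalerA addrAC -addrA.
rewrite -scalerDl addrC; congr (_ + _).
rewrite -[LHS]scale1r; congr (_ *: _).
by rewrite /qhat; field.
Qed.

(** For each pair of columns j < m the letters are reduced to a_j b_m and a_m b_j; the relations of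
    [X] then make the coefficients agree. *)
Lemma coact_braided (a b : 'I_n -> G) : commX a -> commX b ->
  braided q a b -> braided q (coact a) (coact b).
Proof.
move=> ca cb [ea eb be bl bg]; split; try exact: coact_ext.
- move=> t; rewrite !coactM // !sum_pairs scalerDr !scaler_sumr; congr (_ + _).
    by apply: eq_bigr => j _; rewrite be -scalerAr.
  apply: eq_bigr => j _; rewrite scaler_sumr; apply: eq_bigr => m jm.
  rewrite (bl _ _ jm) (bg _ _ jm) (qmatrix_row qX) //.
  set s := X t m * X t j; set z1 := a j * b m; set z2 := a m * b j.
  rewrite mulrDr -!scalerAl -scalerAr scalerDr !scalerA -addrA [RHS]addrC.
  congr (_ + _); rewrite -[X in _ + X = _]scale1r -scalerDl.
  by congr (_ *: _); rewrite /qhat; field.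
- move=> p t pt; rewrite !coactM // !sum_pairs scalerDr [RHS]addrACA.
  congr (_ + _); rewrite scaler_sumr -big_split /=.
    apply: eq_bigr => j _; rewrite be (qmatrix_col qX) //=.
    rewrite -!(scalerAr, scalerAl) scalerA -[X in _ = X + _]scale1r scalerA -scalerDl.
    by congr (_ *: _); rewrite /qhat; field.
  apply: eq_bigr => j _; rewrite scaler_sumr -big_split; apply: eq_bigr => m jm /=.
  rewrite (bl _ _ jm) (bg _ _ jm) (qmatrix_cross qX pt jm) -(qmatrix_comm qX pt jm).
  set x2 := X p m * X t j; set y := X t m * X p j.
  set z1 := a j * b m; set z2 := a m * b j.
  rewrite (mulrDr _ z2) -scalerAr [_ * z2]mulrDl -scalerAl scalerDr.
  rewrite [LHS]addrC -[RHS]addrA; congr (_ + _); rewrite -!addrA; congr (_ + _).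
  exact: addrC.
- move=> p t pt; rewrite !coactM // !sum_pairs; congr (_ + _).
    by apply: eq_bigr => j _; rewrite be (qmatrix_col qX j pt) -!(scalerAr, scalerAl).
  apply: eq_bigr => j _; apply: eq_bigr => m jm /=.
  rewrite (bl _ _ jm) (bg _ _ jm) (qmatrix_cross qX pt jm) -(qmatrix_comm qX pt jm).
  set x2 := X p m * X t j; set y := X t m * X p j.
  set z1 := a j * b m; set z2 := a m * b j.
  rewrite mulrDr mulrDl -scalerAr -scalerAl [RHS]addrC -[LHS]addrA.
  by congr (_ + _); apply: addrC.
Qed.

End Coaction.

(** * Quantum minors as coordinates of the transformed monomials *)

Section MinorExpansion.
Variables (k : fieldType) (n : nat) (q : k) (G : algType k).
Hypothesis q0 : q != 0.
Variable X : 'I_n -> 'I_n -> G.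
Implicit Types (I J : {set 'I_n}).

Definition minorX I J : G :=
  \sum_(s : 'S_#|I|) (- q) ^+ perm_length s *:
    \prod_(l < #|I|) X (enum_val l) (nth (enum_val l) (enum J) (s l)).

(** Counted for words instead of permutations, so that removing the first letter stays within the
    same notion. *)
Definition inversions r (f : 'I_r -> 'I_n) : nat :=
  (\sum_(i < r) \sum_(j < r) ((i < j) && (f j < f i)))%N.

Lemma inversionsS r (f : 'I_r.+1 -> 'I_n) :
  inversions f =
  (\sum_(j < r) (f (lift ord0 j) < f ord0) + inversions (fun l => f (lift ord0 l)))%N.
Proof.
rewrite /inversions big_ord_recl /= big_ord_recl /= add0n; congr (_ + _)%N.
by apply: eq_bigr => i _; rewrite big_ord_recl /= add0n.
Qed.

Variable a : 'I_n -> G.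
Hypothesis ext_a : q_exterior q a.

(** By [mul_aprod], inserting the first letter costs -q for each smaller letter after it, and a
    repeated letter gives 0. *)
Lemma prod_word r (f : 'I_r -> 'I_n) : \prod_(l < r) a (f l) =
  if injectiveb f then (- q) ^+ inversions f *: aprod a (f @: [set: 'I_r]) else 0.
Proof.
elim: r f => [|r IHr] f.
  rewrite big_ord0 (_ : f @: _ = set0); last first.
    by apply/setP=> x; rewrite inE; apply/negP => /imsetP[[]].
  rewrite aprod0 /inversions big_ord0 scale1r.
  by case: injectiveP => // -[] [].
rewrite big_ord_recl IHr.
pose g l := f (lift ord0 l).
have imS : f @: [set: 'I_r.+1] = f ord0 |: (g @: [set: 'I_r]).
  apply/setP=> x; rewrite !inE; apply/imsetP/orP => [[l _ ->]|].
    case: (unliftP ord0 l) => [l' ->|->]; last by left.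
    by right; apply/imsetP; exists l'.
  by case=> [/eqP->|/imsetP[l _ ->]]; [exists ord0 | exists (lift ord0 l)].
case: (injectiveP (fun l => f (lift ord0 l))) => [injg|ninjg]; last first.
  case: injectiveP => injf; last by rewrite mulr0.
  by case: ninjg => x y /injf /lift_inj.
rewrite -scalerAr (mul_aprod ext_a); case: ifP => f0.
  case: injectiveP => injf; last by rewrite scaler0.
  by case/imsetP: f0 => l _ /injf /eqP; rewrite (negbTE (neq_lift _ _)).
case: injectiveP => injf; last first.
  case: injf => x y; case: (unliftP ord0 x) => [x' ->|->];
    case: (unliftP ord0 y) => [y' ->|->] // e.
  - by rewrite (injg _ _ e).
  - by move/negP: f0; case; apply/imsetP; exists x'.
  - by move/negP: f0; case; apply/imsetP; exists y'.
rewrite scalerA -exprD imS; congr (_ ^+ _ *: _).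
rewrite inversionsS addnC; congr (_ + _)%N.
rewrite /below card_sub_sum big_imset /=; last by move=> x y _ _ /injg.
by apply: eq_bigl => l; rewrite inE.
Qed.

Hypothesis cXa : commX X a.

Lemma prod_coact r (e f : 'I_r -> 'I_n) :
  \prod_(l < r) (X (e l) (f l) * a (f l)) =
  \prod_(l < r) X (e l) (f l) * \prod_(l < r) a (f l).
Proof.
elim: r e f => [|r IHr] e f; first by rewrite !big_ord0 mulr1.
rewrite !big_ord_recl (IHr (fun l => e (lift ord0 l)) (fun l => f (lift ord0 l))) -!mulrA.
congr (_ * _); rewrite !mulrA; congr (_ * _).
by apply: commr_prod => l _; apply/commr_sym/cXa.
Qed.

Lemma enum_nth_lt I (d d' : 'I_n) (u v : nat) : (u < #|I|)%N -> (v < #|I|)%N ->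
  (nth d (enum I) u < nth d' (enum I) v)%N = (u < v)%N.
Proof.
rewrite cardE => uI vI; have /(sorted_ltn_nth ltn_trans 0%N) mono := sorted_enum I.
have nthE d0 w : (w < size (enum I))%N -> nth d0 (enum I) w = nth 0%N (map val (enum I)) w :> nat.
  by move=> wI; rewrite (nth_map d0).
rewrite !nthE //; case: (ltngtP u v) => [uv|vu|->]; last by rewrite ltnn.
  by apply: mono; rewrite // inE size_map.
by apply/negbTE; rewrite -leqNgt ltnW //; apply: mono; rewrite // inE size_map.
Qed.

(** After distributing, only injective choices of columns survive. Those with image [J] correspond
    to the permutations of its enumeration, with equal inversion numbers. *)
Lemma aprod_coact I :
  aprod (coact X a) I = \sum_(J : {set 'I_n} | #|J| == #|I|) minorX I J * aprod a J.
Proof.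
set r := #|I|; pose e (l : 'I_r) : 'I_n := enum_val l.
have -> : aprod (coact X a) I = \prod_(l < r) \sum_j X (e l) j * a j.
  rewrite -[aprod _ _]/(\prod_(i <- enum_tuple I) coact X a i) big_tuple.
  by apply: eq_bigr => l _; rewrite (tnth_nth (e l)) -enum_val_nth.
rewrite bigA_distr_bigA /=.
pose w (f : {ffun 'I_r -> 'I_n}) : G :=
  (- q) ^+ inversions f *: \prod_(l < r) X (e l) (f l).
transitivity (\sum_(f : {ffun 'I_r -> 'I_n} | injectiveb f) w f * aprod a (f @: [set: 'I_r])).
  rewrite [RHS]big_mkcond; apply: eq_bigr => f _; rewrite prod_coact prod_word.
  by case: ifP => _; rewrite ?mulr0 // -scalerAr -scalerAl.
rewrite (partition_big (fun f : {ffun 'I_r -> 'I_n} => f @: [set: 'I_r]) (fun J => #|J| == r)) /=.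
  apply: eq_bigr => J /eqP cJ.
  rewrite (eq_bigr (fun f => w f * aprod a J)); last by move=> f /andP[_ /eqP->].
  rewrite -mulr_suml; congr (_ * _).
  pose h (s : 'S_r) : {ffun 'I_r -> 'I_n} := [ffun l => nth (e l) (enum J) (s l)].
  have szJ : size (enum J) = r by rewrite -cardE.
  have sJ (s : 'S_r) l : (s l < size (enum J))%N by rewrite szJ.
  have hinj (s : 'S_r) : injective (h s).
    move=> l m; rewrite !ffunE (set_nth_default (e m)) // => /eqP.
    by rewrite nth_uniq ?enum_uniq // => /eqP/val_inj/perm_inj.
  have injh : injective h.
    move=> s s' /ffunP hs; apply/permP=> l; have := hs l; rewrite !ffunE => /eqP.
    by rewrite nth_uniq ?enum_uniq // => /eqP/val_inj.
  have him (s : 'S_r) : h s @: [set: 'I_r] = J.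
    apply/eqP; rewrite eqEcard card_imset // cardsT card_ord cJ leqnn andbT.
    apply/subsetP=> _ /imsetP[l _ ->]; rewrite ffunE -mem_enum mem_nth //.
  rewrite (eq_bigl (fun f => f \in h @: [set: 'S_r])) => [|f].
    rewrite big_imset /=; last by move=> s s' _ _; apply: injh.
    rewrite /minorX (eq_bigl xpredT) => [|s]; last by rewrite inE.
    apply: eq_bigr => s _; rewrite /w; congr (_ ^+ _ *: _); last first.
      by apply: eq_bigr => l _; rewrite ffunE.
    rewrite /inversions /perm_length -sum1_card [RHS]big_mkcond /=.
    rewrite pair_big /=; apply: eq_bigr => -[l m] _ /=.
    rewrite inE !ffunE /= enum_nth_lt ?cJ //.
  apply/andP/imsetP => [[/injectiveP fi /eqP fJ]|[s _ ->]]; last first.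
    by split; [apply/injectiveP | rewrite him].
  have fl l : f l \in enum J by rewrite mem_enum -fJ imset_f.
  have lt_f l : (index (f l) (enum J) < r)%N by have := fl l; rewrite -index_mem szJ.
  pose g l := Ordinal (lt_f l).
  have gi : injective g.
    by move=> l m [] eq_i; apply: fi; rewrite -(nth_index (e l) (fl l)) eq_i nth_index.
  exists (perm gi) => //; apply/ffunP=> l.
  by rewrite ffunE permE /= nth_index.
by move=> f /injectiveP fi; rewrite card_imset // cardsT card_ord.
Qed.

End MinorExpansion.

(** * A model with independent monomials *)

Section MatrixAlgebra.
Variables (k : fieldType) (G : algType k).

(** The alias keeps only the ring structure, so that scalars come from [k] and not from [G]. *)
Definition mx4 : Type := 'M[G]_4.
HB.instance Definition _ := GRing.NzRing.on mx4.

Definition mx4_scale (c : k) (M : mx4) : mx4 := \matrix_(i, j) (c *: M i j).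

Fact mx4_scalerA a b M : mx4_scale a (mx4_scale b M) = mx4_scale (a * b) M.
Proof. by apply/matrixP=> i j; rewrite !mxE scalerA. Qed.
Fact mx4_scale1r : left_id 1 mx4_scale.
Proof. by move=> M; apply/matrixP=> i j; rewrite !mxE scale1r. Qed.
Fact mx4_scalerDr : right_distributive mx4_scale +%R.
Proof. by move=> c M N; apply/matrixP=> i j; rewrite !mxE scalerDr. Qed.
Fact mx4_scalerDl M : {morph mx4_scale^~ M : a b / a + b}.
Proof. by move=> a b; apply/matrixP=> i j; rewrite !mxE scalerDl. Qed.
HB.instance Definition _ := GRing.Zmodule_isLmodule.Build k mx4
  mx4_scalerA mx4_scale1r mx4_scalerDr mx4_scalerDl.

Fact mx4_scalerAl (c : k) (M N : mx4) : c *: (M * N) = (c *: M) * N.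
Proof.
apply/matrixP=> i j; rewrite !mxE scaler_sumr; apply: eq_bigr => l _.
by rewrite !mxE scalerAl.
Qed.
HB.instance Definition _ := GRing.Lmodule_isLalgebra.Build k mx4 mx4_scalerAl.

Fact mx4_scalerAr (c : k) (M N : mx4) : c *: (M * N) = M * (c *: N).
Proof.
apply/matrixP=> i j; rewrite !mxE scaler_sumr; apply: eq_bigr => l _.
by rewrite !mxE scalerAr.
Qed.
HB.instance Definition _ := GRing.Lalgebra_isAlgebra.Build k mx4 mx4_scalerAr.

(** The pure tensor of [x] and [m] in the tensor product of [G] with M_4(k). *)
Definition tens (x : G) (m : 'M[k]_4) : mx4 := \matrix_(i, j) (m i j *: x).

Lemma tensM x y m m' : tens x m * tens y m' = tens (x * y) (m *m m').
Proof.
apply/matrixP=> i j; rewrite !mxE scaler_suml; apply: eq_bigr => l _.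
by rewrite !mxE -scalerAl -scalerAr scalerA.
Qed.

Lemma tensDl x y m : tens (x + y) m = tens x m + tens y m.
Proof. by apply/matrixP=> i j; rewrite !mxE scalerDr. Qed.

Lemma tensDr x m m' : tens x (m + m') = tens x m + tens x m'.
Proof. by apply/matrixP=> i j; rewrite !mxE scalerDl. Qed.

Lemma tensZl c x m : tens (c *: x) m = c *: tens x m.
Proof. by apply/matrixP=> i j; rewrite !mxE !scalerA mulrC. Qed.

Lemma tensZr c x m : tens x (c *: m) = c *: tens x m.
Proof. by apply/matrixP=> i j; rewrite !mxE scalerA. Qed.

Lemma tens0l m : tens 0 m = 0.
Proof. by apply/matrixP=> i j; rewrite !mxE scaler0. Qed.

Lemma tens0r x : tens x 0 = 0.
Proof. by apply/matrixP=> i j; rewrite !mxE scale0r. Qed.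

End MatrixAlgebra.

Section TensUnit.
Variables (k : fieldType) (A G : algType k) (f : {lrmorphism A -> G}).

Definition tens_unit (x : A) : mx4 G := tens (f x) 1%:M.

Fact tens_unit_linear : linear tens_unit.
Proof. by move=> c x y; rewrite /tens_unit linearP tensDl tensZl. Qed.
HB.instance Definition _ :=
  GRing.isLinear.Build k A (mx4 G) *:%R tens_unit tens_unit_linear.

Fact tens_unit_monoid : monoid_morphism tens_unit.
Proof.
split=> [|x y]; last by rewrite /tens_unit tensM mulmx1 rmorphM.
by rewrite /tens_unit rmorph1; apply/matrixP=> i j; rewrite !mxE scaler_nat.
Qed.
HB.instance Definition _ :=
  GRing.isMonoidMorphism.Build A (mx4 G) tens_unit tens_unit_monoid.

End TensUnit.

Section LocalMatrices.
Variables (k : fieldType) (q : k).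
Hypothesis q0 : q != 0.

Definition mx_of (f : nat -> nat -> k) : 'M[k]_4 := \matrix_(i, j) f i j.

(* Right multiplication on the basis 1, a, b, ab of the one-letter algebra:   *)
(* mx_alpha, mx_beta multiply by a, b; moving a larger letter a' (resp. b')   *)
(* to the left of the basis acts by a' (x) mx_ka + b' (x) mx_eps (resp.       *)
(* b' (x) mx_kb).                                                             *)
Definition mx_ka := mx_of (fun i j => if i == j then if odd i then - q^-1 else 1 else 0).
Definition mx_kb := mx_of (fun i j => if i == j then if (1 < i)%N then - q^-1 else 1 else 0).
Definition mx_eps := mx_of (fun i j => if (i == 2%N) && (j == 1%N) then qhat q else 0).
Definition mx_alpha := mx_of (fun i j =>
  if (i == 0%N) && (j == 1%N) then 1 else if (i == 2%N) && (j == 3%N) then q else 0).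
Definition mx_beta := mx_of (fun i j => (j == i + 2)%N%:R).

Local Ltac local_tac :=
  apply/matrixP; move=> [[|[|[|[|//]]]] ?] [[|[|[|[|//]]]] ?];
  rewrite ?(mxE, big_ord_recl, big_ord0) /= /qhat; by [|ring|field].

Lemma eps_eps : mx_eps *m mx_eps = 0. Proof. local_tac. Qed.
Lemma ka_eps : mx_ka *m mx_eps = mx_eps. Proof. local_tac. Qed.
Lemma eps_ka : mx_eps *m mx_ka = - q^-1 *: mx_eps. Proof. local_tac. Qed.
Lemma kb_eps : mx_kb *m mx_eps = - q^-1 *: mx_eps. Proof. local_tac. Qed.
Lemma eps_kb : mx_eps *m mx_kb = mx_eps. Proof. local_tac. Qed.
Lemma kb_ka : mx_kb *m mx_ka = mx_ka *m mx_kb. Proof. local_tac. Qed.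
Lemma alpha_ka : mx_alpha *m mx_ka = - q^-1 *: mx_alpha. Proof. local_tac. Qed.
Lemma ka_alpha : mx_ka *m mx_alpha = mx_alpha. Proof. local_tac. Qed.
Lemma eps_alpha : mx_eps *m mx_alpha = 0. Proof. local_tac. Qed.
Lemma alpha_eps : mx_alpha *m mx_eps = 0. Proof. local_tac. Qed.
Lemma beta_kb : mx_beta *m mx_kb = - q^-1 *: mx_beta. Proof. local_tac. Qed.
Lemma kb_beta : mx_kb *m mx_beta = mx_beta. Proof. local_tac. Qed.
Lemma kb_alpha : mx_kb *m mx_alpha = mx_alpha *m mx_kb. Proof. local_tac. Qed.
Lemma beta_ka : mx_beta *m mx_ka = mx_ka *m mx_beta. Proof. local_tac. Qed.
Lemma beta_eps : mx_beta *m mx_eps = mx_eps *m mx_beta + qhat q *: (mx_alpha *m mx_kb).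
Proof. local_tac. Qed.
Lemma alpha_alpha : mx_alpha *m mx_alpha = 0. Proof. local_tac. Qed.
Lemma beta_beta : mx_beta *m mx_beta = 0. Proof. local_tac. Qed.
Lemma beta_alpha : mx_beta *m mx_alpha = q *: (mx_alpha *m mx_beta). Proof. local_tac. Qed.

End LocalMatrices.

(** * Adjoining the letters one index at a time *)

Section Model.
Variables (k : fieldType) (n : nat) (q : k) (A : algType k).
Hypothesis q0 : q != 0.
Implicit Types (t p : 'I_n) (J N : {set 'I_n}).

(* The letters smaller than [p] are switched off; the last clause says that   *)
(* the monomials in the remaining letters are independent over A.             *)
Record model (p : nat) (G : algType k) (iota : {lrmorphism A -> G})
    (a b : 'I_n -> G) : Prop := Model {
  model_braided : braided q a b;
  model_zero t : (t < p)%N -> a t = 0 /\ b t = 0;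
  model_comm x t : GRing.comm (iota x) (a t) /\ GRing.comm (iota x) (b t);
  model_coef J N :
    (forall t, t \in J -> (p <= t)%N) -> (forall t, t \in N -> (p <= t)%N) ->
    exists chi : G -> A, [/\ {morph chi : u v / u + v},
      forall c, {morph chi : u / c *: u} &
      forall x J' N', chi (iota x * aprod a J' * aprod b N') =
        if (J' == J) && (N' == N) then x else 0] }.

Lemma aprod_zero (G : algType k) (a : 'I_n -> G) t J :
  t \in J -> a t = 0 -> aprod a J = 0.
Proof.
rewrite -mem_enum /aprod => /splitPr[s1 s2] at0.
by rewrite big_cat big_cons /= at0 mul0r mulr0.
Qed.

Lemma model_base : model n (idfun : {lrmorphism A -> A}) (fun=> 0) (fun=> 0).
Proof.
split=> [|//|x t|J N hJ hN].
- by split=> *; rewrite ?(mul0r, mulr0, scaler0, addr0) //; split=> *;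
    rewrite ?(mul0r, mulr0, scaler0).
- by rewrite /GRing.comm !mul0r !mulr0.
have empty (S : {set 'I_n}) : (forall t, t \in S -> (n <= t)%N) -> S = set0.
  by move=> hS; apply/setP=> t; rewrite inE; apply/negP => /hS; rewrite leqNgt ltn_ord.
exists idfun; split=> // x J' N' /=; rewrite (empty J hJ) (empty N hN).
case: (set_0Vmem J') => [->|[t tJ]]; last first.
  rewrite (aprod_zero tJ) // mulr0 mul0r; case: eqP => // J0.
  by rewrite J0 inE in tJ.
case: (set_0Vmem N') => [->|[t tN]]; last first.
  rewrite (aprod_zero tN) // mulr0 andbC; case: eqP => // N0.
  by rewrite N0 inE in tN.
by rewrite !eqxx !aprod0 !mulr1.
Qed.

Section Step.
Variables (p : 'I_n) (G : algType k) (iota : {lrmorphism A -> G}).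
Variables (a b : 'I_n -> G).
Hypothesis M : model p.+1 iota a b.

Let ab := model_braided M.
Let ea := braided_extl ab.
Let eb := braided_extr ab.

(** Right multiplication in the algebra enlarged by the letters of index p, on the left [G]-basis 1,
    a_p, b_p, a_p b_p. *)
Definition next_a t : mx4 G :=
  if t == p then tens 1 (mx_alpha q) else tens (a t) (mx_ka q) + tens (b t) (mx_eps q).
Definition next_b t : mx4 G :=
  if t == p then tens 1 (mx_beta k) else tens (b t) (mx_kb q).

Lemma next_small t : (t < p)%N -> next_a t = 0 /\ next_b t = 0.
Proof.
move=> tp; have [at0 bt0] := model_zero M (ltnW tp : (t < p.+1)%N).
have tNp : (t == p) = false by apply: contraTF tp => /eqP->; rewrite ltnn.
by rewrite /next_a /next_b tNp at0 bt0 !tens0l addr0.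
Qed.

Lemma next_case (R : 'I_n -> 'I_n -> Prop) :
    (forall s t : 'I_n, (s < p)%N -> R s t) ->
    (forall t, (p < t)%N -> (t == p) = false -> R p t) ->
    (forall s t : 'I_n, (s < t)%N -> (s == p) = false -> (t == p) = false -> R s t) ->
  forall s t : 'I_n, (s < t)%N -> R s t.
Proof.
move=> Rlt Rp Rgt s t st; have [tp|tp] := eqVneq t p.
  by apply: Rlt; rewrite -tp.
have [sp|sp] := eqVneq s p; last by apply: Rgt => //; apply: negbTE.
by rewrite sp in st *; apply: Rp => //; apply: negbTE.
Qed.

Lemma next_comm x t :
  GRing.comm (tens_unit iota x) (next_a t) /\ GRing.comm (tens_unit iota x) (next_b t).
Proof.
have [ca cb] := model_comm M x t; rewrite /next_a /next_b /GRing.comm.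
case: eqP => _; rewrite ?(mulrDl, mulrDr) !tensM !(mulmx1, mul1mx, mulr1, mul1r) //.
by rewrite ca cb.
Qed.

Lemma next_extb : q_exterior q next_b.
Proof.
split=> [t|].
  rewrite /next_b; case: eqP => _; rewrite tensM.
    by rewrite beta_beta tens0r.
  by rewrite (ext_sqr eb) tens0l.
apply: next_case => [s t sp|t pt tp|s t st sp tp].
- by have [_ ->] := next_small sp; rewrite mulr0 mul0r scaler0.
- rewrite /next_b eqxx tp !tensM mul1r mulr1 kb_beta beta_kb // tensZr scalerA.
  by rewrite mulrNN mulfV // scale1r.
- by rewrite /next_b sp tp !tensM (ext_anti eb st) tensZl.
Qed.

Lemma next_exta : q_exterior q next_a.
Proof.
split=> [t|].
  rewrite /next_a; case: eqP => _; first by rewrite tensM alpha_alpha tens0r.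
  rewrite mulrDl !mulrDr !tensM (ext_sqr ea) (ext_sqr eb) eps_eps !tens0l addr0 add0r.
  rewrite ka_eps eps_ka // (braided_eq ab) tensZl tensZr scalerA mulrN mulfV //.
  by rewrite scaleN1r addrN.
apply: next_case => [s t sp|t pt tp|s t st sp tp].
- by have [-> _] := next_small sp; rewrite mulr0 mul0r scaler0.
- rewrite /next_a eqxx tp mulrDl mulrDr !tensM !mul1r !mulr1.
  rewrite ka_alpha eps_alpha alpha_ka // alpha_eps !tens0r !addr0 tensZr scalerA.
  by rewrite mulrNN mulfV // scale1r.
- rewrite /next_a sp tp !mulrDl !mulrDr !tensM eps_eps !tens0r !addr0.
  rewrite !ka_eps !eps_ka // (ext_anti ea st) (braided_lt ab st) (braided_gt ab st).
  rewrite tensZl -!addrA [RHS]scalerDr; congr (_ + _).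
  rewrite !tensZr tensDl tensZl.
  set u := tens (a t * b s) _; set v := tens (a s * b t) _.
  rewrite scalerDr scalerA mulrNN mulfV // scale1r addrCA -scalerDl.
  by congr (_ + _ *: _); rewrite /qhat; ring.
Qed.

Lemma next_braided : braided q next_a next_b.
Proof.
split; [exact: next_exta | exact: next_extb | move=> t | | ].
- rewrite /next_a /next_b; case: eqP => _; first by rewrite !tensM beta_alpha tensZr.
  rewrite mulrDl mulrDr !tensM (ext_sqr eb) !tens0l !addr0 kb_ka (braided_eq ab).
  by rewrite tensZl.
- apply: next_case => [s t sp|t pt tp|s t st sp tp].
  + by have [-> ->] := next_small sp; rewrite !(mulr0, mul0r) scaler0 addr0.
  + rewrite /next_a /next_b !eqxx tp mulrDl mulrDr !tensM !mul1r !mulr1.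
    by rewrite beta_ka beta_eps // tensDr tensZr addrA.
  + rewrite /next_a /next_b sp tp !mulrDl !mulrDr !tensM kb_ka kb_eps // !eps_kb.
    rewrite (braided_lt ab st) (ext_anti eb st) tensDl !tensZl tensZr !scalerDr.
    rewrite -[LHS]addrA -[RHS]addrA [X in _ = _ + X]addrCA -scalerDl.
    by congr (_ + (_ + _ *: _)); rewrite /qhat; ring.
- apply: next_case => [s t sp|t pt tp|s t st sp tp].
  + by have [-> _] := next_small sp; rewrite mulr0 mul0r.
  + rewrite /next_a /next_b !eqxx tp !tensM !mul1r !mulr1.
    by rewrite kb_alpha.
  + rewrite /next_a /next_b sp tp mulrDl mulrDr !tensM kb_ka kb_eps // eps_kb.
    rewrite (braided_gt ab st) (ext_anti eb st) tensZl tensZr scalerA mulrNN mulfV //.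
    by rewrite scale1r.
Qed.

(** The position of a_p^x b_p^y in the basis 1, a_p, b_p, a_p b_p. *)
Definition code (x y : bool) : 'I_4 := inord (x + y.*2).

(** Row 0 is the image of the basis vector 1, so it holds the coordinates of the element itself;
    here there is only one, in position [s]. *)
Definition at_col (W : mx4 G) (s : 'I_4) (x : G) :=
  forall j, W 0 j = if j == s then x else 0.

Lemma at_col_tens W s x y m j : at_col W s x -> (W * tens y m) 0 j = m s j *: (x * y).
Proof.
move=> h; rewrite mxE (bigD1 s) //= h eqxx mxE big1 => [|l ls].
  by rewrite addr0 -scalerAr.
by rewrite h (negbTE ls) mul0r.
Qed.

Let r := - q^-1.

(** Position 2 is b_p, the only row where [mx_eps] is nonzero. It is avoided in a_J b_N, where the
    a's come first. *)
Lemma at_col_next_a W (s : 'I_4) x t : at_col W s x -> t != p -> s != 2%N :> nat ->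
  at_col (W * next_a t) s ((if odd s then r else 1) *: (x * a t)).
Proof.
move=> h /negbTE tp s2 j; rewrite /next_a tp mulrDr mxE !(at_col_tens _ _ _ h) !mxE.
rewrite (negbTE s2) scale0r addr0 -(inj_eq val_inj) [j == s :> nat]eq_sym.
by case: eqP => //= _; rewrite scale0r.
Qed.

Lemma at_col_next_b W (s : 'I_4) x t : at_col W s x -> t != p ->
  at_col (W * next_b t) s ((if (1 < s)%N then r else 1) *: (x * b t)).
Proof.
move=> h /negbTE tp j; rewrite /next_b tp (at_col_tens _ _ _ h) !mxE.
rewrite -(inj_eq val_inj) [j == s :> nat]eq_sym.
by case: eqP => //= _; rewrite scale0r.
Qed.

Lemma at_col_prod (f : 'I_n -> mx4 G) (g : 'I_n -> G) (c : k) s w :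
    (forall t W x, t \in w -> at_col W s x -> at_col (W * f t) s (c *: (x * g t))) ->
  forall W x, at_col W s x ->
    at_col (W * \prod_(t <- w) f t) s (c ^+ size w *: (x * \prod_(t <- w) g t)).
Proof.
elim: w => [|t w IHw] hw W x hW; first by rewrite !big_nil !mulr1 scale1r.
rewrite !big_cons (mulrA W) (mulrA x) /= exprSr -scalerA scalerAl.
apply: IHw => [t' W' x' tw|]; last by apply: hw; rewrite ?mem_head.
by apply: hw; rewrite inE tw orbT.
Qed.

(** The cost of moving a_p to the right of l larger a's, and b_p to the right of m larger b's. *)
Definition mono_coef (x y : bool) (l m : nat) : k := r ^+ (x * l + y * m).

Lemma at_col_monomial x (J N : {set 'I_n}) :
    (forall t, t \in J -> (p <= t)%N) -> (forall t, t \in N -> (p <= t)%N) ->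
  at_col (tens_unit iota x * aprod next_a J * aprod next_b N)
    (code (p \in J) (p \in N))
    (mono_coef (p \in J) (p \in N) #|J :\ p| #|N :\ p| *:
       (iota x * aprod a (J :\ p) * aprod b (N :\ p))).
Proof.
move=> hJ hN.
have codeE u v : val (code u v) = (u + v.*2)%N by rewrite /= inordK //; case: u; case: v.
have split (f : 'I_n -> mx4 G) (S : {set 'I_n}) : (forall t, t \in S -> (p <= t)%N) ->
    aprod f S = (if p \in S then f p else 1) * aprod f (S :\ p).
  move=> hS; case: ifP => pS; last first.
    rewrite mul1r; congr aprod; apply/setP=> t; rewrite !inE.
    by case: eqP => // ->.
  rewrite -{1}(setD1K pS) aprodU1 // => t; rewrite !inE => /andP[tp /hS].
  by rewrite leq_eqVlt eq_sym (inj_eq val_inj) (negbTE tp).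
rewrite (split _ _ hJ) (split _ _ hN) !mulrA.
have notp S t : t \in enum (S :\ p) -> t != p by rewrite mem_enum !inE => /andP[].
have h0 : at_col (tens_unit iota x * (if p \in J then next_a p else 1))
    (code (p \in J) false) (iota x).
  have h j : tens_unit iota x 0 j = if j == 0 then iota x else 0.
    rewrite mxE mxE eq_sym; case: eqP => _; by rewrite ?scale1r ?scale0r.
  case: (p \in J); last first.
    by move=> j; rewrite mulr1 h -!(inj_eq val_inj) codeE.
  move=> j; rewrite /next_a eqxx (at_col_tens _ _ _ h) mxE mulr1.
  by rewrite -(inj_eq val_inj) codeE /=; case: eqP; rewrite ?scale1r ?scale0r.
have h1 : at_col (tens_unit iota x * (if p \in J then next_a p else 1) * aprod next_a (J :\ p))
    (code (p \in J) false)
    ((if p \in J then r else 1) ^+ #|J :\ p| *: (iota x * aprod a (J :\ p))).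
  rewrite cardE; apply: at_col_prod h0 => t W y tJ hW.
  have := at_col_next_a hW (notp _ _ tJ); rewrite codeE.
  by case: (p \in J) => /=; apply.
set y := _ *: _ in h1; set W := _ * _ in h1.
have h2 : at_col (W * (if p \in N then next_b p else 1)) (code (p \in J) (p \in N)) y.
  case: (p \in N); last by rewrite mulr1.
  move=> j; rewrite /next_b eqxx (at_col_tens _ _ _ h1) mxE mulr1.
  rewrite -(inj_eq val_inj) !codeE /= addn0.
  by case: eqP; rewrite ?scale1r ?scale0r.
have h3 : at_col (W * (if p \in N then next_b p else 1) * aprod next_b (N :\ p))
    (code (p \in J) (p \in N))
    ((if p \in N then r else 1) ^+ #|N :\ p| *: (y * aprod b (N :\ p))).
  rewrite cardE; apply: at_col_prod h2 => t W' y' tN hW.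
  have := at_col_next_b hW (notp _ _ tN); rewrite codeE.
  by case: (p \in J); case: (p \in N).
have -> : mono_coef (p \in J) (p \in N) #|J :\ p| #|N :\ p| *:
    (iota x * aprod a (J :\ p) * aprod b (N :\ p)) =
   (if p \in N then r else 1) ^+ #|N :\ p| *: (y * aprod b (N :\ p)).
  rewrite /y -scalerAl scalerA /mono_coef exprD mulrC; congr (_ * _ *: _).
    by case: (p \in N); rewrite ?mul1n // mul0n expr1n.
  by case: (p \in J); rewrite ?mul1n // mul0n expr1n.
exact: h3.
Qed.

Lemma model_step : model p (tens_unit iota : {lrmorphism A -> mx4 G}) next_a next_b.
Proof.
split; [exact: next_braided | exact: next_small | exact: next_comm | move=> J N hJ hN].
have hD (S : {set 'I_n}) : (forall t, t \in S -> (p <= t)%N) ->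
    forall t, t \in S :\ p -> (p.+1 <= t)%N.
  move=> hS t; rewrite !inE => /andP[tp /hS].
  by rewrite leq_eqVlt eq_sym (inj_eq val_inj) (negbTE tp).
have [chi [chiD chiZ chiE]] := model_coef M (hD _ hJ) (hD _ hN).
have chi0 : chi 0 = 0 by rewrite -(scale0r 0) chiZ scale0r.
pose c := mono_coef (p \in J) (p \in N) #|J :\ p| #|N :\ p|.
have c0 : c != 0 by rewrite expf_neq0 // oppr_eq0 invr_eq0.
pose s := code (p \in J) (p \in N).
(* Column [s] detects which letters of index p occur, the old functional detects the others, and
   c^-1 removes the factor of [mono_coef]. *)
exists (fun W : mx4 G => c^-1 *: chi (W 0 s)); split=> [u v|d u|x J' N'].
- by rewrite mxE chiD scalerDr.
- by rewrite mxE chiZ !scalerA mulrC.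
have small (S S' : {set 'I_n}) t : (forall t, t \in S -> (p <= t)%N) ->
    t \in S' -> (t < p)%N -> (S' == S) = false.
  by move=> hS tS' tp; apply/eqP => S'S; rewrite S'S in tS'; move: (hS _ tS'); rewrite leqNgt tp.
have [/existsP[t /andP[tJ tp]]|/existsPn lJ] := boolP [exists t, (t \in J') && (t < p)%N].
  rewrite (aprod_zero tJ); last by case: (next_small tp).
  by rewrite mulr0 mul0r mxE chi0 scaler0 (small _ _ _ hJ tJ tp).
have [/existsP[t /andP[tN tp]]|/existsPn lN] := boolP [exists t, (t \in N') && (t < p)%N].
  rewrite (aprod_zero tN); last by case: (next_small tp).
  by rewrite mulr0 mxE chi0 scaler0 (small _ _ _ hN tN tp) andbF.
have hJ' t : t \in J' -> (p <= t)%N by move=> tJ; move: (lJ t); rewrite tJ -leqNgt.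
have hN' t : t \in N' -> (p <= t)%N by move=> tN; move: (lN t); rewrite tN -leqNgt.
rewrite (at_col_monomial x hJ' hN').
have [es|ns] := eqVneq s (code (p \in J') (p \in N')); last first.
  rewrite chi0 scaler0; case: andP => // -[/eqP JJ /eqP NN].
  by rewrite JJ NN eqxx in ns.
have [pJ pN] : (p \in J) = (p \in J') /\ (p \in N) = (p \in N').
  move/(congr1 val): es; rewrite /= !inordK.
  - by case: (p \in J); case: (p \in J'); case: (p \in N); case: (p \in N').
  - by case: (p \in J'); case: (p \in N').
  - by case: (p \in J); case: (p \in N).
have eqD (S S' : {set 'I_n}) : (p \in S) = (p \in S') -> (S' :\ p == S :\ p) = (S' == S).
  move=> pS; apply/eqP/eqP => [/setP e|->//]; apply/setP=> t.
  by have := e t; rewrite !inE; case: eqP => [->|].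
rewrite chiZ chiE eqD // eqD // scalerA; case: andP => [[/eqP-> /eqP->]|_].
  by rewrite -/c mulVf // scale1r.
by rewrite scaler0.
Qed.

End Step.

(** Starting from [A] itself with all letters zero, the indices are activated from the largest
    downwards. *)
Lemma model_exists (p : nat) : (p <= n)%N ->
  exists (G : algType k) (iota : {lrmorphism A -> G}) (a b : 'I_n -> G),
    model p iota a b.
Proof.
move=> pn; rewrite -(subKn pn); elim: (n - p)%N (leq_subr p n) => [|m IHm] mn.
  by rewrite subn0; exists A, idfun, (fun=> 0), (fun=> 0); apply: model_base.
have [G [iota [a [b M]]]] := IHm (ltnW mn).
have lt_n : (n - m.+1 < n)%N by rewrite ltn_subrL (leq_trans _ mn).
pose p0 := Ordinal lt_n.
have M' : model p0.+1 iota a b by rewrite /= -subSn ?subSS.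
exists (mx4 G), (tens_unit iota : {lrmorphism A -> mx4 G}), (next_a p0 a b), (next_b p0 b).
exact: (model_step M').
Qed.

End Model.

(** * Comparison of coefficients *)

Section QuantumMatrixAlgebra.
Variables (k : fieldType) (q : k) (n : nat).

Lemma algpi_relator x : Oq_relator q (@freeX_gen k n) x ->
  algpi (Oq_relator q (@freeX_gen k n)) x = 0.
Proof.
move=> hx; rewrite -[0 in RHS](subrr (algpi (Oq_relator q (@freeX_gen k n)) 0)) -algpiB.
by apply/algpiP; rewrite !subr0; apply: ideal_gen_gen.
Qed.

Lemma Oq_genM i j l m : Oq_gen q i j * Oq_gen q l m =
  algpi (Oq_relator q (@freeX_gen k n)) (freeX_gen k i j * freeX_gen k l m) :> Oq q n.
Proof. exact: algquot_mulE. Qed.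

Lemma algpiZ c x : algpi (Oq_relator q (@freeX_gen k n)) (c *: x) =
  c *: (algpi (Oq_relator q (@freeX_gen k n)) x : Oq q n).
Proof. by apply/esym/algquot_scaleE. Qed.

Lemma Oq_qmatrix : qmatrix q (@Oq_gen k q n).
Proof.
split=> [i l j il|i j m jm|i j l m il mj|i j l m il jm]; rewrite !Oq_genM -?algpiZ;
  apply/eqP; rewrite -subr_eq0 ?opprD ?addrA -?algpiB; apply/eqP/algpi_relator.
- exact: Oq_relator_col.
- exact: Oq_relator_row.
- exact: Oq_relator_comm.
- exact: Oq_relator_cross.
Qed.

End QuantumMatrixAlgebra.

(** * From the reordering coefficients to lambda and mu *)

Section KernelSupport.
Variables (k : fieldType) (n : nat).
Implicit Types (I J M N P S T U V X Y : {set 'I_n}).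

(** If the order fails, T :\: J has more elements up to some t than J :\: T. At the largest such
    element the truncated subtraction in [xi] gives 0, and [qint q 0] is an empty sum. *)
Lemma xi_setle (q : k) J T :
  #|J| = #|T| -> xi q (T :\: J) (J :\: T) != 0 -> setle J T.
Proof.
move=> cJT; apply: contraNT => nle.
pose upto S (x : 'I_n) := #|[set v in S | (v <= x)%N]|.
have uptoE S x : upto S x = (below S x + (x \in S))%N.
  rewrite /upto /below !card_sub_sum; case: (boolP (x \in S)) => xS.
    rewrite (big_setD1 x xS) [in RHS](big_setD1 x xS) /= leqnn ltnn add0n addnC.
    congr (_ + _)%N; apply: eq_bigr => v; rewrite !inE => /andP[vx _].
    by rewrite leq_eqVlt (inj_eq val_inj) (negbTE vx).
  rewrite addn0; apply: eq_bigr => v vS; rewrite leq_eqVlt (inj_eq val_inj).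
  by case: eqP vS xS => [->->|].
have uptoI S S' x : upto S x = (upto (S :&: S') x + upto (S :\: S') x)%N.
  rewrite /upto -(cardsID S'); congr (_ + _)%N; apply: eq_card => v; rewrite !inE.
    by rewrite andbAC.
  by rewrite andbA.
have [t lt_t] : exists t, (upto J t < upto T t)%N.
  move: nle; rewrite /setle all2E -!cardE cJT eqxx /= => /allPn[[x y]].
  case/(nthP (x, y)) => l; rewrite size_zip -!cardE cJT minnn => lT.
  rewrite nth_zip -?cardE // => -[ex ey]; rewrite /= -ltnNge => lt_yx; exists y.
  have lJ : (l < #|J|)%N by rewrite cJT.
  have bT : below T y = l.
    by rewrite -[RHS](enum_val_below (Ordinal lT)) (enum_val_nth y) /= ey.
  have bJ : below J x = l.
    by rewrite -[RHS](enum_val_below (Ordinal lJ)) (enum_val_nth x) /= ex.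
  have yT : y \in T by rewrite -mem_enum -ey mem_nth // -cardE.
  rewrite [upto T y]uptoE yT bT addn1 ltnS -bJ; apply: subset_leq_card.
  apply/subsetP=> v; rewrite !inE => /andP[-> vy] /=.
  exact: leq_ltn_trans vy lt_yx.
set U := T :\: J; set V := J :\: T.
have lt_UV : (upto V t < upto U t)%N.
  by move: lt_t; rewrite (uptoI J T) (uptoI T J) setIC ltn_add2l.
have [u0 u0U] : exists u, (u \in U) && (u <= t)%N.
  have /card_gt0P[u] : (0 < upto U t)%N by apply: leq_ltn_trans lt_UV.
  by rewrite inE; exists u.
case: (@arg_maxnP _ u0 (fun u => (u \in U) && (u <= t)%N) val u0U) => u /andP[uU ut] umax.
rewrite xi_prod (bigD1 u) //= mulf_eq0; apply/orP; left.
suff -> : (#|[set v in V | (v <= u)%N]| - below U u = 0)%N by rewrite /qint big_ord0.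
have eU : (below U u).+1 = upto U u by rewrite uptoE uU addn1.
apply/eqP; rewrite subn_eq0 -ltnS eU.
have -> : upto U u = upto U t.
  apply: eq_card => v; rewrite !inE; case: (boolP (v \in U)); rewrite ?inE => vU; last first.
    by rewrite (negbTE vU).
  rewrite vU /=; apply/idP/idP => [/leq_trans->//|vt].
  by apply: umax; rewrite inE vU.
apply: leq_ltn_trans lt_UV; apply: subset_leq_card; apply/subsetP=> v.
by rewrite !inE => /andP[-> /leq_trans->].
Qed.

Lemma admissible_natset X Y S S' : admissible Y X S S' =
  [&& S \subset X :|: Y, X :&: Y \subset S, #|S| == #|X| & S' == natset X Y S].
Proof.
apply/admissibleP/and4P => [[hI hU hc]|[/subsetP h1 /subsetP h2 /eqP hc /eqP->]].
  split.
  - by apply/subsetP=> x xS; rewrite !inE orbC -hU xS.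
  - apply/subsetP=> x; rewrite !inE andbC => h; have := hI x; rewrite h.
    by case/andP.
  - by rewrite hc.
  - apply/eqP/setP=> x; have := hU x; have := hI x; rewrite !inE.
    by case: (x \in S); case: (x \in S'); case: (x \in X); case: (x \in Y).
split=> // x; have := h1 x; have := h2 x; rewrite !inE;
  case: (x \in S); case: (x \in X); case: (x \in Y) => //= h h';
  by [rewrite h|rewrite h'|case: (h isT)|case: (h' isT)|].
Qed.

(** For mu the target (J,N) is fixed and the source (P,T) varies, so [admissible_natset] has to be
    read backwards. *)
Lemma admissible_sym P T J N : admissible P T J N = admissible N J T P.
Proof.
rewrite /admissible [T :&: P]setIC [N :&: J]setIC [T :|: P]setUC [N :|: J]setUC.
by rewrite ![P :&: T == _]eq_sym ![P :|: T == _]eq_sym [#|T| == _]eq_sym.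
Qed.

End KernelSupport.

Section Coefficients.
Variables (k : fieldType) (n : nat) (q : k).
Hypothesis q0 : q != 0.
Implicit Types (I J M N P S T X Y : {set 'I_n}).

(** Under q -> q^-1, [qhat] and the exponent of -q change sign while [xi] is unchanged; the
    auxiliary set of [kernel] is the one in [calL]. *)
Lemma kernel_lamt I M S :
    [&& S \subset I :|: M, I :&: M \subset S & #|S| == #|I|] ->
  kernel q^-1 M I S (natset I M S) = q ^- #|I :&: M| * lamt q I M S.
Proof.
case/and3P=> h1 h2 h3.
have adm : admissible M I S (natset I M S).
  by rewrite admissible_natset h1 h2 h3 eqxx.
rewrite /kernel adm; case/and3P: (adm) => /eqP -> _ _.
rewrite [M :&: I]setIC exprVn; congr (_ * _).
rewrite /kweight /lamt qhatV (xiV q0) -!mulrA; congr (_ * _).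
have -> : (M :|: I) :\: (I :&: M) :\: (I :\: S) = (S :\: natset I M S) :|: (M :\: I).
  move/subsetP: h1 => h1; move/subsetP: h2 => h2; apply/setP=> x.
  have := h1 x; have := h2 x; rewrite !inE.
  by case: (x \in S); case: (x \in I); case: (x \in M) => //= h h';
    first [by have := h isT | by have := h' isT].
by rewrite -invrN exprz_inv.
Qed.

Lemma kernel_mu J N T :
    [&& T \subset J :|: N, J :&: N \subset T & #|T| == #|J|] ->
  kernel q (natset J N T) T J N = q ^+ #|J :&: N| * mu q J N T.
Proof.
case/and3P=> h1 h2 h3.
have adm : admissible (natset J N T) T J N.
  by rewrite admissible_sym admissible_natset h1 h2 h3 eqxx.
rewrite /kernel adm; congr (_ * _).
rewrite /kweight /mu.
have -> // : (natset J N T :|: T) :\: (natset J N T :&: T) :\: (T :\: J) =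
  (natset J N T :\: T) :|: (J :\: N).
move/subsetP: h1 => h1; move/subsetP: h2 => h2; apply/setP=> x.
have := h1 x; have := h2 x; rewrite !inE.
by case: (x \in T); case: (x \in J); case: (x \in N) => //= h h';
  first [by have := h isT | by have := h' isT].
Qed.

Lemma sum_kernel_lower (G : lmodType k) I M (F : {set 'I_n} -> {set 'I_n} -> G) :
  \sum_S \sum_S' kernel q^-1 M I S S' *: F S S' =
  \sum_(S in lower_sets I M) (q ^- #|I :&: M| * lamt q I M S) *: F S (natset I M S).
Proof.
rewrite [RHS]big_mkcond; apply: eq_bigr => S _; rewrite (bigD1 (natset I M S)) //=.
rewrite [X in _ + X]big1 ?addr0 => [|S' nS']; last first.
  by rewrite /kernel admissible_natset (negbTE nS') !andbF scale0r.
have [h|h] := boolP [&& S \subset I :|: M, I :&: M \subset S & #|S| == #|I|]; last first.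
  rewrite /kernel admissible_natset eqxx andbT (negbTE h) scale0r inE.
  by case: ifP => // /and4P[h1 h2 h3 _]; rewrite h1 h2 h3 in h.
rewrite kernel_lamt // inE; case/and3P: (h) => -> -> cS; rewrite cS /=.
case: ifP => // nle; rewrite /lamt (_ : xi q _ _ = 0) ?mulr0 ?scale0r //.
by apply/eqP; apply: contraFT nle; apply: xi_setle; apply/eqP.
Qed.

Lemma sum_kernel_upper (G : lmodType k) J N (F : {set 'I_n} -> {set 'I_n} -> G) :
  \sum_P \sum_T kernel q P T J N *: F P T =
  \sum_(T in upper_sets J N) (q ^+ #|J :&: N| * mu q J N T) *: F (natset J N T) T.
Proof.
rewrite exchange_big [RHS]big_mkcond; apply: eq_bigr => T _ /=.
rewrite (bigD1 (natset J N T)) //=.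
rewrite [X in _ + X]big1 ?addr0 => [|P nP]; last first.
  by rewrite /kernel admissible_sym admissible_natset (negbTE nP) !andbF scale0r.
have [h|h] := boolP [&& T \subset J :|: N, J :&: N \subset T & #|T| == #|J|]; last first.
  rewrite /kernel admissible_sym admissible_natset eqxx andbT (negbTE h) scale0r inE.
  by case: ifP => // /and4P[h1 h2 h3 _]; rewrite h1 h2 h3 in h.
rewrite kernel_mu // inE; case/and3P: (h) => -> -> cT; rewrite cT /=.
case: ifP => // nle; rewrite /mu (_ : xi q _ _ = 0) ?mulr0 ?scale0r //.
by apply/eqP; apply: contraFT nle; apply: xi_setle; apply/eqP; rewrite eq_sym.
Qed.

Lemma ell0 S : ell S set0 = 0%N.
Proof. by rewrite ell_sum big1 // => s _; rewrite big_set0. Qed.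

Lemma lamt_id I M : lamt q I M I = 1.
Proof.
rewrite /lamt /calL setDv !ell0 subrr oppr0 cards0 expr0 expr0z !mul1r.
by rewrite xi_prod big_set0.
Qed.

Lemma mu_id J N : mu q J N J = 1.
Proof.
rewrite /mu /calLnat setDv !ell0 subrr cards0 expr0 expr0z !mul1r.
by rewrite xi_prod big_set0.
Qed.

Lemma natset_id X Y : natset X Y X = Y.
Proof. by apply/setP=> x; rewrite !inE; case: (x \in X); case: (x \in Y). Qed.

Lemma setle_refl X : setle X X.
Proof. by rewrite /setle; elim: (enum X) => //= x s ->; rewrite leqnn. Qed.

Lemma lower_sets_id X Y : X \in lower_sets X Y.
Proof. by rewrite inE subsetUl subsetIl eqxx setle_refl. Qed.

Lemma upper_sets_id X Y : X \in upper_sets X Y.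
Proof. by rewrite inE subsetUl subsetIl eqxx setle_refl. Qed.

End Coefficients.

(** * Comparing the coefficients of a_J b_N *)

Section MinorCommutation.
Variables (k : fieldType) (n : nat) (q : k).
Hypothesis q0 : q != 0.
Implicit Types (I J M N P S T : {set 'I_n}).

Lemma rmorph_qminor (G : algType k) (iota : {lrmorphism Oq q n -> G}) I J :
  iota (qminor q I J) = minorX q (fun i j => iota (Oq_gen q i j)) I J.
Proof.
rewrite /qminor /minorX linear_sum; apply: eq_bigr => s _.
by rewrite /= linearZ /= rmorph_prod.
Qed.

Lemma lrmorph_qmatrix (G : algType k) (iota : {lrmorphism Oq q n -> G}) :
  qmatrix q (fun i j => iota (Oq_gen q i j)).
Proof.
have [hc hr hm hx] := @Oq_qmatrix k q n.
split=> [i l j h|i j m h|i j l m h h'|i j l m h h']; rewrite -!rmorphM.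
- by rewrite (hc _ _ _ h) /= linearZ.
- by rewrite (hr _ _ _ h) /= linearZ.
- by rewrite (hm _ _ _ _ h h').
- by rewrite (hx _ _ _ _ h h') /= linearD linearZ.
Qed.

(** Both sides are the a_J b_N coefficient of a'_I b'_M, computed directly and after two
    reorderings. *)
Lemma minor_commutation I J M N : #|I| = #|J| -> #|M| = #|N| ->
  qminor q I J * qminor q M N =
  \sum_S \sum_S' kernel q^-1 M I S S' *:
    \sum_P \sum_T kernel q P T J N *: (qminor q S' P * qminor q S T).
Proof.
move=> cIJ cMN.
have [G [iota [a [b mod]]]] := model_exists (Oq q n) q0 (leq0n n).
have [ab _ comm coef] := mod.
(* [chi] extracts the coefficient of a_J b_N; at p = 0 every letter is active and the support
   conditions are trivial. *)
have [chi [chiD chiZ chiE]] := coef J N (fun _ _ => isT) (fun _ _ => isT).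
have chi0 : chi 0 = 0 by rewrite -(scale0r 0) chiZ scale0r.
have chi_sum (Q : finType) (p : pred Q) (F : Q -> G) :
    chi (\sum_(i | p i) F i) = \sum_(i | p i) chi (F i) by apply: big_morph.
pose X i j := iota (Oq_gen q i j).
have qX : qmatrix q X := lrmorph_qmatrix iota.
have ca : commX X a by move=> i j t; case: (comm (Oq_gen q i j) t).
have cb : commX X b by move=> i j t; case: (comm (Oq_gen q i j) t).
have ab' := coact_braided q0 qX ca cb ab.
have expand (c : 'I_n -> G) U : commX X c -> q_exterior q c -> aprod (coact X c) U =
    \sum_(V : {set 'I_n} | #|V| == #|U|) iota (qminor q U V) * aprod c V.
  move=> cX ec; rewrite (aprod_coact ec cX).
  by apply: eq_bigr => V _; rewrite rmorph_qminor.
have prod_expand (c d : 'I_n -> G) U V : commX X c -> q_exterior q c ->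
    commX X d -> q_exterior q d ->
    (forall x t, GRing.comm (iota x) (c t)) ->
    aprod (coact X c) U * aprod (coact X d) V =
    \sum_(U' : {set 'I_n} | #|U'| == #|U|) \sum_(V' : {set 'I_n} | #|V'| == #|V|)
      iota (qminor q U U' * qminor q V V') * (aprod c U' * aprod d V').
  move=> cc ec cd ed ic; rewrite expand // expand // big_distrlr /=.
  apply: eq_bigr => U' _; apply: eq_bigr => V' _.
  rewrite rmorphM -!mulrA; congr (_ * _); rewrite !mulrA; congr (_ * _).
  by apply/esym/commr_prod => t _; apply: ic.
have [ea eb _ _ _] := ab.
have icA x t : GRing.comm (iota x) (a t) by case: (comm x t).
have icB x t : GRing.comm (iota x) (b t) by case: (comm x t).
have chi_ab x J' N' : chi (iota x * (aprod a J' * aprod b N')) =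
    if (J' == J) && (N' == N) then x else 0 by rewrite mulrA chiE.
have E1 : chi (aprod (coact X a) I * aprod (coact X b) M) = qminor q I J * qminor q M N.
  rewrite prod_expand // chi_sum (bigD1 J) ?cIJ //= chi_sum (bigD1 N) ?cMN //=.
  rewrite chi_ab !eqxx big1 => [|N' /andP[_ nN]]; last first.
    by rewrite chi_ab (negbTE nN) andbF.
  rewrite big1 ?addr0 // => J' /andP[_ nJ].
  by rewrite chi_sum big1 // => N' _; rewrite chi_ab (negbTE nJ).
rewrite -E1 (reorder_conv q0 ab') chi_sum; apply: eq_bigr => S _.
rewrite chi_sum; apply: eq_bigr => S' _; rewrite chiZ.
have [admS|] := boolP (admissible M I S S'); last first.
  by rewrite /kernel => /negbTE->; rewrite !scale0r.
congr (_ *: _).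
have chi_mul x (c : k) J' N' :
    chi (iota x * (c *: (aprod a J' * aprod b N'))) =
    c *: (if (J' == J) && (N' == N) then x else 0).
  by rewrite -scalerAr chiZ chi_ab.
have chi_ba x P T : chi (iota x * (aprod b P * aprod a T)) =
    kernel q P T J N *: x.
  rewrite (reorder q0 ab) mulr_sumr chi_sum (bigD1 J) //=.
  rewrite mulr_sumr chi_sum (bigD1 N) //= chi_mul !eqxx /= !big1 ?addr0 // => [J' nJ|N' nN].
    by rewrite mulr_sumr chi_sum big1 // => N' _; rewrite chi_mul (negbTE nJ) scaler0.
  by rewrite chi_mul (negbTE nN) andbF scaler0.
rewrite prod_expand // chi_sum big_mkcond; apply: eq_bigr => P _.
(* The minor expansions run over sets of these cardinalities only; as [kernel] vanishes elsewhere,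
   the sums may be extended to all [P] and [T]. *)
have cardP T : admissible P T J N -> #|P| = #|S'| /\ #|T| = #|S|.
  move=> adm; rewrite -(admissible_card adm) -cMN -(admissible_card admS).
  by case/admissibleP: adm => _ _ <-; case/admissibleP: admS => _ _ ->.
case: eqP => cP; last first.
  rewrite big1 // => T _; rewrite /kernel; case: ifP => [/cardP[]//|_].
  by rewrite scale0r.
rewrite chi_sum big_mkcond; apply: eq_bigr => T _; rewrite chi_ba.
case: eqP => // cT; rewrite /kernel; case: ifP => [/cardP[]//|_].
by rewrite scale0r.
Qed.

End MinorCommutation.

(** The rearrangement does not depend on what is summed, so an arbitrary [F] stands for the products
    of minors. The power q^(-#|I :&: M|) from [kernel_lamt] is cleared, and the term (I,J), with
    coefficient 1, is split off. *)
Lemma kernel_sumE (k : fieldType) (n : nat) (q : k) (V : lmodType k)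
    (I J M N : {set 'I_n}) (F : {set 'I_n} -> {set 'I_n} -> {set 'I_n} -> {set 'I_n} -> V) :
    q != 0 ->
  q ^+ #|I :&: M| *: (\sum_S \sum_S' kernel q^-1 M I S S' *:
    \sum_P \sum_T kernel q P T J N *: F S' P S T) =
  q ^+ #|J :&: N| *: F M N I J + q ^+ #|J :&: N| *:
    \sum_(S in lower_sets I M) \sum_(T in upper_sets J N | (S, T) != (I, J))
      (lamt q I M S * mu q J N T) *: F (natset I M S) (natset J N T) S T.
Proof.
move=> q0; set c := #|I :&: M|; set d := #|J :&: N|.
pose H S T := (lamt q I M S * mu q J N T) *: F (natset I M S) (natset J N T) S T.
rewrite (sum_kernel_lower q0) -/c.
transitivity (q ^+ d *: \sum_(S in lower_sets I M) \sum_(T in upper_sets J N) H S T).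
  rewrite !scaler_sumr; apply: eq_bigr => S _; rewrite scalerA mulrA mulfV ?expf_neq0 // mul1r.
  rewrite (sum_kernel_upper q J N (fun P T => F (natset I M S) P S T)) -/d.
  rewrite !scaler_sumr; apply: eq_bigr => T _; rewrite /H !scalerA; congr (_ *: _).
  by rewrite mulrCA.
rewrite -scalerDr; congr (_ *: _).
have -> : F M N I J = H I J by rewrite /H !natset_id lamt_id mu_id mulr1 scale1r.
rewrite (bigD1 I) ?lower_sets_id //= [in RHS](bigD1 I) ?lower_sets_id //= addrA.
congr (_ + _).
  rewrite (bigD1 J) ?upper_sets_id //=; congr (_ + _); apply: eq_bigl => T.
  by rewrite xpair_eqE eqxx.
apply: eq_bigr => S /andP[_ SI]; apply: eq_bigl => T.
by rewrite xpair_eqE (negbTE SI) andbT.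
Qed.

Theorem theorem6p3 (k : fieldType) (n : nat) (hn : (0 < n)%N)
    (q : k) (hq : q != 0)
    (I J M N : {set 'I_n}) (hIJ : #|I| = #|J|) (hMN : #|M| = #|N|) :
  q ^+ #|I :&: M| *: (qminor q I J * qminor q M N) =
    q ^+ #|J :&: N| *: (qminor q M N * qminor q I J) +
    q ^+ #|J :&: N| *:
      (\sum_(S in lower_sets I M)
        \sum_(T in upper_sets J N | (S, T) != (I, J))
          (lamt q I M S * mu q J N T) *:
            (qminor q (natset I M S) (natset J N T) * qminor q S T)).
Proof.
rewrite (minor_commutation hq hIJ hMN).
exact: (@kernel_sumE k n q (Oq q n) I J M N (fun S' P S T => qminor q S' P * qminor q S T) hq).
Qed.
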